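(* Let $m\ge 2$, let $\mathcal S_1,\mathcal S_2\subseteq\{1,\dots,m\}$, $\mathbf a=(a_1,\dots,a_m)\in(\mathbb{C}^\times)^m$, $\mathbf b=(b_1,\dots,b_m)\in(\mathbb{C}^\times)^m$ and $\mathbf k=(k_1,\dots,k_m)\in\mathbb{Z}_{\ge1}^m$. Then $$E\Bigl(\sum_{i=1}^m a_i x_i^{k_i},\mathcal S_1\Bigr)\simeq E\Bigl(\sum_{i=1}^m b_i x_i^{k_i},\mathcal S_2\Bigr)$$ as $\mathcal U(\mathfrak{sl}(m|1))$-modules if and only if there exists $g\in G_{\mathbf k}$ such that $\operatorname{Supp}(g)=\mathcal S_1\triangle\mathcal S_2$ (symmetric difference) and $(g\cdot\mathbf a)_{\mathcal S_2}=\mathbf b_{\mathcal S_2}$ in the weighted projective space $\mathbb P(\mathbf k)$.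
   Context: Everything is over $\mathbb{C}$. Index rows and columns of $(m+1)\times(m+1)$ matrices by $1,\dots,m,\bar 1$, with matrix units $e_{pq}$. The Lie superalgebra $\mathfrak{sl}(m|1)$ is spanned by the even elements $h_i:=e_{ii}+e_{\bar1\bar1}$ ($1\le i\le m$), $e_{ij}$ ($1\le i\ne j\le m$) and the odd elements $e_{i\bar1},e_{\bar1 i}$ ($1\le i\le m$), with bracket $[u,v]=uv-(-1)^{\bar u\bar v}vu$. Modules and their isomorphisms are $\mathbb{Z}_2$-graded. Exponential modules. For $g\in\mathbb{C}[x_1,\dots,x_m]$ and $\mathcal S\subseteq\{1,\dots,m\}$, $E(g,\mathcal S)$ is the vector space $\mathbb{C}[x_1,\dots,x_m,\xi]\,e^{g}=\mathbb{C}[x_1,\dots,x_m]e^g\oplus\mathbb{C}[x_1,\dots,x_m]\xi e^g$ ($\xi$ odd, $\xi^2=0$; the first summand is even, the second odd). For $f\in\mathbb{C}[x_1,\dots,x_m]$, $\varepsilon\in\{0,1\}$, define operators on it: $x_i$ acts by multiplication; $\partial_{x_i}(f\xi^\varepsilon e^g)=\bigl(\frac{\partial f}{\partial x_i}+f\frac{\partial g}{\partial x_i}\bigr)\xi^\varepsilon e^g$; $\xi\cdot(f\xi^\varepsilon e^g)=(1-\varepsilon)f\xi e^g$; $\partial_\xi(f\xi^\varepsilon e^g)=\varepsilon f e^g$. The $\mathfrak{sl}(m|1)$-action is: $h_i\mapsto x_i\partial_{x_i}+\xi\partial_\xi$ if $i\notin\mathcal S$ and $h_i\mapsto -x_i\partial_{x_i}-1+\xi\partial_\xi$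 if $i\in\mathcal S$; for $i\neq j$, $e_{ij}\mapsto x_i\partial_{x_j}$ ($i,j\notin\mathcal S$), $\partial_{x_i}\partial_{x_j}$ ($i\in\mathcal S,j\notin\mathcal S$), $-x_ix_j$ ($i\notin\mathcal S,j\in\mathcal S$), $-x_j\partial_{x_i}$ ($i,j\in\mathcal S$); $e_{i\bar1}\mapsto x_i\partial_\xi$ ($i\notin\mathcal S$), $\partial_{x_i}\partial_\xi$ ($i\in\mathcal S$); $e_{\bar1 i}\mapsto \xi\partial_{x_i}$ ($i\notin\mathcal S$), $-x_i\xi$ ($i\in\mathcal S$). Parameters. $N(\mathbf k):=\{i: k_i=2\}$ and $G_{\mathbf k}:=(\mathbb{Z}/2\mathbb{Z})^{N(\mathbf k)}$, with elements $\varepsilon=(\varepsilon_i)_{i\in N(\mathbf k)}$, $\varepsilon_i\in\{0,1\}$, and $\operatorname{Supp}(\varepsilon):=\{i\in N(\mathbf k):\varepsilon_i=1\}$. $G_{\mathbf k}$ acts on $(\mathbb{C}^\times)^m$ by $(\varepsilon\cdot\mathbf a)_i=a_i$ if $k_i\ne2$ and $(\varepsilon\cdot\mathbf a)_i=(-\tfrac14)^{\varepsilon_i}a_i^{1-2\varepsilon_i}$ if $k_i=2$. For $\mathcal S\subseteq\{1,\dots,m\}$ and $\mathbf a\in(\mathbb{C}^\times)^m$, the tuple $\mathbf a_{\mathcal S}\in(\mathbb{C}^\times)^m$ is given by $(\mathbf a_{\mathcal S})_i=a_i$ if $i\in\mathcal S$ and $a_i^{-1}$ if $i\notin\mathcal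 S$. $\mathbb P(\mathbf k)$ is the weighted projective space with weights $k_1,\dots,k_m$: two tuples $\mathbf c,\mathbf d\in(\mathbb{C}^\times)^m$ are equal in $\mathbb P(\mathbf k)$ iff there is $\lambda\in\mathbb{C}^\times$ with $c_i=\lambda^{k_i}d_i$ for all $i$. *)

(* Defs.v *)
From HB Require Import structures.
From mathcomp Require Import all_boot all_order all_algebra.
From mathcomp Require Import mpoly ring.
Set Implicit Arguments.
Unset Strict Implicit.
Unset Printing Implicit Defensive.
Import GRing.Theory.
Local Open Scope ring_scope.

(* Everything is written over an arbitrary field F; it is used with F = R[i],
   R : realType. *)

(* The matrix indices 1, ..., m, \bar 1 are the elements of 'I_(m + 1), the
   last one being \bar 1; the index i : 'I_m (counted from 0) stands for
   i + 1. *)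
Definition ix m (i : 'I_m) : 'I_(m + 1) := lshift 1 i.
Definition ixbar m : 'I_(m + 1) := rshift m (ord0 : 'I_1).
Arguments ixbar {m}.

Definition sl_h (F : fieldType) m (i : 'I_m) : 'M[F]_(m + 1) :=
  delta_mx (ix i) (ix i) + delta_mx ixbar ixbar.

(* sl_part F m false and sl_part F m true are the even and the odd part. *)
Definition sl_part (F : fieldType) m (p : bool) : {vspace 'M[F]_(m + 1)} :=
  if p then
    <<[seq delta_mx (ix i) ixbar | i : 'I_m] ++
      [seq delta_mx ixbar (ix i) | i : 'I_m]>>%VS
  else
    <<[seq sl_h F i | i : 'I_m] ++
      [seq delta_mx (ix u.1) (ix u.2)
        | u in [pred u : 'I_m * 'I_m | u.1 != u.2]]>>%VS.

Definition sl (F : fieldType) m : {vspace 'M[F]_(m + 1)} :=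
  (sl_part F m false + sl_part F m true)%VS.

(* The bracket of two homogeneous elements, of parities p and q. *)
Definition sbracket (F : fieldType) m (p q : bool) (X Y : 'M[F]_(m + 1)) :
    'M[F]_(m + 1) :=
  X *m Y - (-1) ^+ (p && q) *: (Y *m X).

(* The Z_2-graded module is V0 * V1, with V0 * 0 even and 0 * V1 odd. *)
Definition has_parity (V0 V1 : zmodType) (p : bool) (v : V0 * V1) : Prop :=
  if p then v.1 = 0 else v.2 = 0.

(* A Z_2-graded U(sl(m|1))-module is given, by the universal property of the
   enveloping algebra, by a Z_2-graded vector space with a linear action of
   sl(m|1) compatible with the grading and the bracket. Only the values of
   sl_act on sl F m are relevant. *)
Record sl_module (F : fieldType) (m : nat) := SlModule {
  sl_even : lmodType F;
  sl_odd : lmodType F;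
  sl_act : 'M[F]_(m + 1) -> sl_even * sl_odd -> sl_even * sl_odd;
  sl_act_linear : forall X, X \in sl F m -> linear (sl_act X);
  sl_act_linearl : forall (c : F) X Y v, X \in sl F m -> Y \in sl F m ->
    sl_act (c *: X + Y) v = c *: sl_act X v + sl_act Y v;
  sl_act_homog : forall (p q : bool) X v, X \in sl_part F m p ->
    has_parity q v -> has_parity (p (+) q) (sl_act X v);
  sl_act_bracket : forall (p q : bool) X Y v,
    X \in sl_part F m p -> Y \in sl_part F m q ->
    sl_act (sbracket p q X Y) v =
      sl_act X (sl_act Y v) - (-1) ^+ (p && q) *: sl_act Y (sl_act X v)
}.

Definition sl_iso (F : fieldType) m (V W : sl_module F m) : Prop :=
  exists phi : {linear (sl_even V * sl_odd V)%type ->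
                       (sl_even W * sl_odd W)%type},
    [/\ bijective phi,
        forall (p : bool) v, has_parity p v -> has_parity p (phi v) &
        forall X v, X \in sl F m -> phi (sl_act X v) = sl_act X (phi v)].

(* The pair (f0, f1) stands for f0 e^g + f1 \xi e^g. *)
Notation expvec F m := ({mpoly F[m]} * {mpoly F[m]})%type.

Definition op_x (F : fieldType) m (i : 'I_m) (v : expvec F m) : expvec F m :=
  ('X_i * v.1, 'X_i * v.2).

Definition op_dx (F : fieldType) m (g : {mpoly F[m]}) (i : 'I_m)
    (v : expvec F m) : expvec F m :=
  (v.1^`M(i) + v.1 * g^`M(i), v.2^`M(i) + v.2 * g^`M(i)).

Definition op_xi (F : fieldType) m (v : expvec F m) : expvec F m := (0, v.1).

Definition op_dxi (F : fieldType) m (v : expvec F m) : expvec F m := (v.2, 0).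

Definition exp_h (F : fieldType) m (g : {mpoly F[m]}) (S : {set 'I_m})
    (i : 'I_m) (v : expvec F m) : expvec F m :=
  if i \in S then - op_x i (op_dx g i v) - v + op_xi (op_dxi v)
  else op_x i (op_dx g i v) + op_xi (op_dxi v).

Definition exp_e (F : fieldType) m (g : {mpoly F[m]}) (S : {set 'I_m})
    (i j : 'I_m) (v : expvec F m) : expvec F m :=
  match i \in S, j \in S with
  | false, false => op_x i (op_dx g j v)
  | true, false => op_dx g i (op_dx g j v)
  | false, true => - op_x i (op_x j v)
  | true, true => - op_x j (op_dx g i v)
  end.

Definition exp_ebar (F : fieldType) m (g : {mpoly F[m]}) (S : {set 'I_m})
    (i : 'I_m) (v : expvec F m) : expvec F m :=
  if i \in S then op_dx g i (op_dxi v) else op_x i (op_dxi v).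

Definition exp_bare (F : fieldType) m (g : {mpoly F[m]}) (S : {set 'I_m})
    (i : 'I_m) (v : expvec F m) : expvec F m :=
  if i \in S then - op_x i (op_xi v) else op_xi (op_dx g i v).

(* The linear extension of h_i |-> exp_h i, e_(ij) |-> exp_e i j,
   e_(i \bar 1) |-> exp_ebar i, e_(\bar 1 i) |-> exp_bare i: the coefficient of
   h_i in X \in sl F m is X_(ii), and X_(\bar 1 \bar 1) is the sum of these. *)
Definition exp_act (F : fieldType) m (g : {mpoly F[m]}) (S : {set 'I_m})
    (X : 'M[F]_(m + 1)) (v : expvec F m) : expvec F m :=
  \sum_i X (ix i) (ix i) *: exp_h g S i v +
  \sum_i \sum_(j | j != i) X (ix i) (ix j) *: exp_e g S i j v +
  \sum_i X (ix i) ixbar *: exp_ebar g S i v +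
  \sum_i X ixbar (ix i) *: exp_bare g S i v.

Lemma span_ker (F : fieldType) (V : vectType F) (W : lmodType F)
    (f : {linear V -> W}) (s : seq V) (v : V) :
  (forall u, u \in s -> f u = 0) -> v \in <<s>>%VS -> f v = 0.
Proof.
move=> f0 vs; rewrite (coord_span (X := in_tuple s) vs) linear_sum big1 // => i _.
by rewrite linearZ /= f0 ?scaler0 // mem_nth.
Qed.

Lemma ix_eq m (i j : 'I_m) : (ix i == ix j) = (i == j).
Proof. by rewrite -!val_eqE. Qed.

Lemma ix_bar m (i : 'I_m) : (ix i == ixbar) = false.
Proof. by rewrite -val_eqE /= addn0 ltn_eqF. Qed.

Lemma bar_ix m (i : 'I_m) : (ixbar == ix i) = false.
Proof. by rewrite eq_sym ix_bar. Qed.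

(* parity of a matrix index *)
Definition ipar m (p : 'I_(m + 1)) : bool := p == ixbar.

Lemma ipar_ix m (i : 'I_m) : ipar (ix i) = false. Proof. exact: ix_bar. Qed.
Lemma ipar_bar m : ipar (ixbar : 'I_(m + 1)). Proof. exact: eqxx. Qed.

Lemma big_ix (W : zmodType) m (G : 'I_(m + 1) -> W) :
  \sum_p G p = \sum_i G (ix i) + G ixbar.
Proof. by rewrite big_split_ord big_ord1. Qed.

Lemma ixP m (P : 'I_(m + 1) -> Prop) :
  (forall i, P (ix i)) -> P ixbar -> forall p, P p.
Proof.
move=> Pi Pb p; case: (split_ordP p) => j ->; [exact: Pi | by rewrite (ord1 j)].
Qed.

Definition supertrace (F : fieldType) m (X : 'M[F]_(m + 1)) : F^o :=
  \sum_i X (ix i) (ix i) - X ixbar ixbar.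

Lemma supertrace_linear (F : fieldType) m : linear (@supertrace F m).
Proof.
move=> c X Y; rewrite /supertrace scalerBr scaler_sumr mxE.
have -> : \sum_i (c *: X + Y) (ix i) (ix i) =
    \sum_i c * X (ix i) (ix i) + \sum_i Y (ix i) (ix i).
  by rewrite -big_split; apply: eq_bigr => i _; rewrite !mxE.
by rewrite mxE opprD addrACA.
Qed.

HB.instance Definition _ (F : fieldType) m :=
  GRing.isLinear.Build F 'M[F]_(m + 1) F^o _ (@supertrace F m)
    (@supertrace_linear F m).

Definition entry (F : fieldType) m (p q : 'I_(m + 1)) (X : 'M[F]_(m + 1)) : F^o :=
  X p q.

Lemma entry_linear (F : fieldType) m p q : linear (@entry F m p q).
Proof. by move=> c X Y; rewrite /entry !mxE. Qed.

HB.instance Definition _ (F : fieldType) m p q :=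
  GRing.isLinear.Build F 'M[F]_(m + 1) F^o _ (@entry F m p q)
    (@entry_linear F m p q).

Lemma sl_part_supertrace (F : fieldType) m p X :
  X \in sl_part F m p -> supertrace X = 0.
Proof.
case: p => Xp; apply: (span_ker (f := @supertrace F m) _ Xp) => u;
  rewrite mem_cat => /orP[] /imageP[].
- by move=> i _ ->; rewrite /= /supertrace big1 ?mxE ?bar_ix ?subr0 // => k _;
    rewrite mxE ix_bar andbF.
- by move=> i _ ->; rewrite /= /supertrace big1 ?mxE ?bar_ix ?andbF ?subr0 // => k _;
    rewrite mxE ix_bar.
- move=> i _ ->; rewrite /= /supertrace (bigD1 i) //= big1 ?addr0.
    by rewrite !mxE !eqxx !ix_bar !bar_ix addr0 add0r subrr.
  by move=> k /negPf ki; rewrite !mxE ix_eq ki !ix_bar addr0.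
- move=> [i j] /= ij ->; rewrite /= /supertrace big1 ?mxE ?bar_ix ?subr0 // => k _.
  rewrite mxE !ix_eq; case: eqP => //= ->; move: ij; rewrite inE /= => /negPf.
  by rewrite /= => ->.
Qed.

Lemma sl_part_entry (F : fieldType) m p (X : 'M[F]_(m + 1)) r s :
  X \in sl_part F m p -> ipar r (+) ipar s != p -> X r s = 0.
Proof.
case: p => Xp rs; apply: (span_ker (f := @entry F m r s) _ Xp) => u {Xp X};
  move: rs; rewrite mem_cat => + /orP[] /imageP[].
- move=> rs i _ ->; rewrite /= /entry mxE; case: andP => // -[/eqP rE /eqP sE].
  by move: rs; rewrite rE sE ipar_ix ipar_bar.
- move=> rs i _ ->; rewrite /= /entry mxE; case: andP => // -[/eqP rE /eqP sE].
  by move: rs; rewrite rE sE ipar_ix ipar_bar.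
- move=> rs i _ ->; rewrite /= /entry !mxE.
  have H t : ((r == t) && (s == t)) = false.
    by apply/negP => /andP[/eqP rt /eqP st]; move: rs; rewrite rt st addbb.
  by rewrite !H addr0.
- move=> rs [i j] _ ->; rewrite /= /entry mxE; case: andP => // -[/eqP rE /eqP sE].
  by move: rs; rewrite rE sE !ipar_ix.
Qed.

Lemma sl_supertrace (F : fieldType) m X : X \in sl F m -> supertrace X = 0.
Proof.
case/memv_addP => u /sl_part_supertrace u0 [v /sl_part_supertrace v0 ->].
by rewrite linearD /= u0 v0 addr0.
Qed.

Lemma sl_part_sub (F : fieldType) m p X : X \in sl_part F m p -> X \in sl F m.
Proof.
rewrite /sl; case: p => h; first by rewrite (subvP (addvSr _ _)).
by rewrite (subvP (addvSl _ _)).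
Qed.

(* gen_a p o gen_b q represents the matrix unit e_(pq) of gl(m|1). *)
Definition gen_a (F : fieldType) m (g : {mpoly F[m]}) (S : {set 'I_m})
    (p : 'I_(m + 1)) (v : expvec F m) : expvec F m :=
  match split p with
  | inl i => if i \in S then op_dx g i v else op_x i v
  | inr _ => op_xi v
  end.

Definition gen_b (F : fieldType) m (g : {mpoly F[m]}) (S : {set 'I_m})
    (p : 'I_(m + 1)) (v : expvec F m) : expvec F m :=
  match split p with
  | inl i => if i \in S then - op_x i v else op_dx g i v
  | inr _ => op_dxi v
  end.

Lemma gen_a_ix (F : fieldType) m (g : {mpoly F[m]}) S i v :
  gen_a g S (ix i) v = if i \in S then op_dx g i v else op_x i v.
Proof. by rewrite /gen_a (unsplitK (inl i)). Qed.

Lemma gen_a_bar (F : fieldType) m (g : {mpoly F[m]}) S v :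
  gen_a g S ixbar v = op_xi v.
Proof. by rewrite /gen_a (unsplitK (inr ord0)). Qed.

Lemma gen_b_ix (F : fieldType) m (g : {mpoly F[m]}) S i v :
  gen_b g S (ix i) v = if i \in S then - op_x i v else op_dx g i v.
Proof. by rewrite /gen_b (unsplitK (inl i)). Qed.

Lemma gen_b_bar (F : fieldType) m (g : {mpoly F[m]}) S v :
  gen_b g S ixbar v = op_dxi v.
Proof. by rewrite /gen_b (unsplitK (inr ord0)). Qed.

Lemma expvec_eq (F : fieldType) m (u v : expvec F m) :
  u.1 = v.1 -> u.2 = v.2 -> u = v.
Proof. by case: u v => ? ? [? ?] /= -> ->. Qed.

Lemma op_x_linear (F : fieldType) m (i : 'I_m) : linear (@op_x F m i).
Proof. by move=> c u v; apply: expvec_eq; rewrite /= mulrDr scalerAr. Qed.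

Lemma op_dx_linear (F : fieldType) m (g : {mpoly F[m]}) i : linear (op_dx g i).
Proof.
by move=> c u v; apply: expvec_eq; rewrite /= linearP /= mulrDl scalerDr scalerAl;
  rewrite addrACA.
Qed.

Lemma op_xi_linear (F : fieldType) m : linear (@op_xi F m).
Proof. by move=> c u v; apply: expvec_eq; rewrite //= scaler0 addr0. Qed.

Lemma op_dxi_linear (F : fieldType) m : linear (@op_dxi F m).
Proof. by move=> c u v; apply: expvec_eq; rewrite //= scaler0 addr0. Qed.

Lemma gen_a_linear (F : fieldType) m (g : {mpoly F[m]}) S p :
  linear (gen_a g S p).
Proof.
move=> c u v; elim/ixP: p => [i|]; rewrite ?gen_a_ix ?gen_a_bar; last first.
  exact: op_xi_linear.
by case: ifP => _; [exact: op_dx_linear | exact: op_x_linear].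
Qed.

Lemma gen_b_linear (F : fieldType) m (g : {mpoly F[m]}) S p :
  linear (gen_b g S p).
Proof.
move=> c u v; elim/ixP: p => [i|]; rewrite ?gen_b_ix ?gen_b_bar; last first.
  exact: op_dxi_linear.
case: ifP => _; last exact: op_dx_linear.
by rewrite op_x_linear opprD scalerN.
Qed.

HB.instance Definition _ (F : fieldType) m (g : {mpoly F[m]}) S p :=
  GRing.isLinear.Build F (expvec F m) (expvec F m) _ (gen_a g S p)
    (gen_a_linear g S p).
HB.instance Definition _ (F : fieldType) m (g : {mpoly F[m]}) S p :=
  GRing.isLinear.Build F (expvec F m) (expvec F m) _ (gen_b g S p)
    (gen_b_linear g S p).

Lemma mderivXi (F : fieldType) m (i j : 'I_m) :
  ('X_i : {mpoly F[m]})^`M(j) = (j == i)%:R.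
Proof.
rewrite mderivX mnm1E eq_sym; case: eqP => [->|_]; last by rewrite scale0r.
rewrite scale1r -[RHS]mpolyX0; congr (mpolyX _ _).
by apply/mnmP => k; rewrite mnmBE subnn mnm0E.
Qed.

Lemma op_xC (F : fieldType) m (i j : 'I_m) (v : expvec F m) :
  op_x i (op_x j v) = op_x j (op_x i v).
Proof. by apply: expvec_eq; rewrite /= mulrCA. Qed.

Lemma op_dxC (F : fieldType) m (g : {mpoly F[m]}) i j v :
  op_dx g i (op_dx g j v) = op_dx g j (op_dx g i v).
Proof.
have H f : (f^`M(j) + f * g^`M(j))^`M(i) + (f^`M(j) + f * g^`M(j)) * g^`M(i) =
           (f^`M(i) + f * g^`M(i))^`M(j) + (f^`M(i) + f * g^`M(i)) * g^`M(j).
  by rewrite !mderivD !mderivM [g^`M(j)^`M(i)]mderiv_comm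
    [f^`M(j)^`M(i)]mderiv_comm; ring.
by apply: expvec_eq; rewrite /= H.
Qed.

Lemma op_dx_x (F : fieldType) m (g : {mpoly F[m]}) i j v :
  op_dx g j (op_x i v) = (j == i)%:R *: v + op_x i (op_dx g j v).
Proof.
have H f : ('X_i * f)^`M(j) + 'X_i * f * g^`M(j) =
    (j == i)%:R *: f + 'X_i * (f^`M(j) + f * g^`M(j)).
  rewrite mderivM mderivXi mulrDr addrA mulrA; congr (_ + _ + _).
  by case: eqP => _; rewrite ?mul1r ?scale1r ?mul0r ?scale0r.
by apply: expvec_eq; rewrite /= H.
Qed.

Lemma op_xiC (F : fieldType) m (g : {mpoly F[m]}) i (v : expvec F m) :
  [/\ op_xi (op_x i v) = op_x i (op_xi v),
      op_dxi (op_x i v) = op_x i (op_dxi v),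
      op_xi (op_dx g i v) = op_dx g i (op_xi v) &
      op_dxi (op_dx g i v) = op_dx g i (op_dxi v)].
Proof.
by split; apply: expvec_eq; rewrite //= ?mulr0 ?linear0 ?mul0r ?addr0.
Qed.

Lemma op_xiN (F : fieldType) m (v : expvec F m) : op_xi (- v) = - op_xi v.
Proof. by apply: expvec_eq; rewrite /= ?oppr0. Qed.

Lemma op_dxiN (F : fieldType) m (v : expvec F m) : op_dxi (- v) = - op_dxi v.
Proof. by apply: expvec_eq; rewrite /= ?oppr0. Qed.

Lemma op_xN (F : fieldType) m (i : 'I_m) (v : expvec F m) :
  op_x i (- v) = - op_x i v.
Proof. by apply: expvec_eq; rewrite /= mulrN. Qed.

Lemma op_dxN (F : fieldType) m (g : {mpoly F[m]}) i v :
  op_dx g i (- v) = - op_dx g i v.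
Proof. by apply: expvec_eq; rewrite /= mderivN mulNr opprD. Qed.

Lemma gen_a_parity (F : fieldType) m (g : {mpoly F[m]}) S p q v :
  has_parity q v -> has_parity (ipar p (+) q) (gen_a g S p v).
Proof.
elim/ixP: p => [i|]; rewrite ?gen_a_ix ?gen_a_bar ?ipar_ix ?ipar_bar.
  by case: ifP => _; case: q => /= ->; rewrite ?mulr0 ?linear0 ?mul0r ?addr0.
by case: q.
Qed.

Lemma gen_b_parity (F : fieldType) m (g : {mpoly F[m]}) S p q v :
  has_parity q v -> has_parity (ipar p (+) q) (gen_b g S p v).
Proof.
elim/ixP: p => [i|]; rewrite ?gen_b_ix ?gen_b_bar ?ipar_ix ?ipar_bar.
  by case: ifP => _; case: q => /= ->;
    rewrite ?mulr0 ?linear0 ?mul0r ?addr0 ?oppr0.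
by case: q.
Qed.

Lemma gen_aa (F : fieldType) m (g : {mpoly F[m]}) S p q v :
  gen_a g S p (gen_a g S q v) =
  (-1) ^+ (ipar p && ipar q) *: gen_a g S q (gen_a g S p v).
Proof.
elim/ixP: p => [i|]; elim/ixP: q => [j|];
  rewrite !(gen_a_ix, gen_a_bar) ?ipar_ix ?ipar_bar /= ?scale1r.
- have [->//|ij] := eqVneq i j.
  case: ifP => _; case: ifP => _.
  + exact: op_dxC.
  + by rewrite op_dx_x (negPf ij) scale0r add0r.
  + by rewrite op_dx_x eq_sym (negPf ij) scale0r add0r.
  + exact: op_xC.
- by have [h1 _ h2 _] := op_xiC g i v; case: ifP.
- by have [h1 _ h2 _] := op_xiC g j v; case: ifP.
- by apply: expvec_eq; rewrite /= ?scaler0.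
Qed.

Lemma gen_bb (F : fieldType) m (g : {mpoly F[m]}) S p q v :
  gen_b g S p (gen_b g S q v) =
  (-1) ^+ (ipar p && ipar q) *: gen_b g S q (gen_b g S p v).
Proof.
elim/ixP: p => [i|]; elim/ixP: q => [j|];
  rewrite !(gen_b_ix, gen_b_bar) ?ipar_ix ?ipar_bar /= ?scale1r.
- have [->//|ij] := eqVneq i j.
  case: ifP => _; case: ifP => _; rewrite ?op_xN ?op_dxN.
  + by rewrite op_xC.
  + by rewrite op_dx_x eq_sym (negPf ij) scale0r add0r.
  + by rewrite op_dx_x (negPf ij) scale0r add0r.
  + exact: op_dxC.
- by have [_ h1 _ h2] := op_xiC g i v; case: ifP; rewrite ?op_dxiN ?h1.
- by have [_ h1 _ h2] := op_xiC g j v; case: ifP; rewrite ?op_dxiN ?h1.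
- by apply: expvec_eq; rewrite /= ?scaler0.
Qed.

Lemma gen_ba (F : fieldType) m (g : {mpoly F[m]}) S q r v :
  gen_b g S q (gen_a g S r v) =
  (q == r)%:R *: v + (-1) ^+ (ipar q && ipar r) *: gen_a g S r (gen_b g S q v).
Proof.
elim/ixP: q => [j|]; elim/ixP: r => [i|];
  rewrite !(gen_b_ix, gen_b_bar, gen_a_ix, gen_a_bar) ?ipar_ix ?ipar_bar /=;
  rewrite ?ix_eq ?ix_bar ?bar_ix ?eqxx ?scale0r ?add0r ?scale1r.
- case: ifP => jS; case: ifP => iS; rewrite ?op_dxN ?op_xN ?op_dx_x //.
  + by rewrite opprD eq_sym addNKr.
  + have -> : (j == i) = false by apply/eqP => ji; rewrite ji iS in jS.
    by rewrite scale0r add0r op_xC.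
  + have -> : (j == i) = false by apply/eqP => ji; rewrite ji iS in jS.
    by rewrite scale0r add0r op_dxC.
- by have [h1 _ h2 _] := op_xiC g j v; case: ifP; rewrite ?op_xiN ?h1.
- by have [_ h1 _ h2] := op_xiC g i v; case: ifP.
- by case: v => f0 f1; apply: expvec_eq; rewrite /= scaleN1r ?oppr0 ?addr0 ?subrr.
Qed.

Definition gl_act (F : fieldType) m (g : {mpoly F[m]}) S
    (X : 'M[F]_(m + 1)) (v : expvec F m) : expvec F m :=
  \sum_p \sum_q X p q *: gen_a g S p (gen_b g S q v).

Lemma exp_actE (F : fieldType) m (g : {mpoly F[m]}) S X v :
  supertrace X = 0 -> exp_act g S X v = gl_act g S X v.
Proof.
move=> /eqP; rewrite subr_eq0 => /eqP tr.
have hA : \sum_i X (ix i) (ix i) *: exp_h g S i v =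
    \sum_i X (ix i) (ix i) *: gen_a g S (ix i) (gen_b g S (ix i) v) +
    X ixbar ixbar *: gen_a g S ixbar (gen_b g S ixbar v).
  rewrite -tr scaler_suml -big_split; apply: eq_bigr => i _ /=.
  rewrite -scalerDr gen_a_bar gen_b_bar gen_a_ix gen_b_ix /exp_h.
  case: ifP => _ //; rewrite op_dxN op_dx_x eqxx scale1r opprD.
  by rewrite [- v - _]addrC.
have hB : \sum_i \sum_(j | j != i) X (ix i) (ix j) *: exp_e g S i j v =
    \sum_i \sum_(j | j != i)
      X (ix i) (ix j) *: gen_a g S (ix i) (gen_b g S (ix j) v).
  apply: eq_bigr => i _; apply: eq_bigr => j ij.
  rewrite gen_a_ix gen_b_ix /exp_e; case: ifP => _; case: ifP => _ //.
    by rewrite op_dxN op_dx_x eq_sym (negPf ij) scale0r add0r.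
  by rewrite op_xN.
have hC : \sum_i X (ix i) ixbar *: exp_ebar g S i v =
    \sum_i X (ix i) ixbar *: gen_a g S (ix i) (gen_b g S ixbar v).
  by apply: eq_bigr => i _; rewrite gen_a_ix gen_b_bar.
have hD : \sum_i X ixbar (ix i) *: exp_bare g S i v =
    \sum_i X ixbar (ix i) *: gen_a g S ixbar (gen_b g S (ix i) v).
  apply: eq_bigr => i _; rewrite gen_a_bar gen_b_ix /exp_bare.
  by case: ifP => _ //; rewrite op_xiN; have [-> _ _ _] := op_xiC g i v.
rewrite /exp_act hA hB hC hD /gl_act big_ix [X in _ = _ + X]big_ix.
rewrite (eq_bigr _ (fun i _ => big_ix _)) big_split /=.
rewrite [\sum_i \sum_i0 _](eq_bigr _ (fun i _ => bigD1 i isT)) big_split /=.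
rewrite -!addrA; congr (_ + _).
by rewrite addrC -!addrA.
Qed.

Lemma gl_act_linear (F : fieldType) m (g : {mpoly F[m]}) S X :
  linear (gl_act g S X).
Proof.
move=> c u v; rewrite /gl_act scaler_sumr -big_split; apply: eq_bigr => p _ /=.
rewrite scaler_sumr -big_split; apply: eq_bigr => q _ /=.
by rewrite gen_b_linear gen_a_linear scalerDr !scalerA mulrC.
Qed.

Lemma gl_act_linearl (F : fieldType) m (g : {mpoly F[m]}) S c X Y v :
  gl_act g S (c *: X + Y) v = c *: gl_act g S X v + gl_act g S Y v.
Proof.
rewrite /gl_act scaler_sumr -big_split; apply: eq_bigr => p _ /=.
rewrite scaler_sumr -big_split; apply: eq_bigr => q _ /=.
by rewrite !mxE scalerDl scalerA.
Qed.

Lemma has_parity_sum (F : fieldType) (V0 V1 : lmodType F) p (I : finType)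
    (c : I -> F) (v : I -> V0 * V1) :
  (forall i, c i != 0 -> has_parity p (v i)) ->
  has_parity p (\sum_i c i *: v i).
Proof.
move=> h; elim/big_ind: _ => [|u w|i _].
- by case: p {h}.
- by case: p {h} => /= -> ->; rewrite addr0.
- have [->|/h] := eqVneq (c i) 0; first by rewrite scale0r; case: p {h}.
  by case: p {h} => /= ->; rewrite scaler0.
Qed.

Lemma gl_act_parity (F : fieldType) m (g : {mpoly F[m]}) S p q X v :
  X \in sl_part F m p -> has_parity q v ->
  has_parity (p (+) q) (gl_act g S X v).
Proof.
move=> Xp vq; rewrite /gl_act pair_bigA.
apply: (has_parity_sum (c := fun u => X u.1 u.2)) => -[r s] /= rs.
have <- : ipar r (+) ipar s = p.
  by apply/eqP; apply: contraNT rs => /(sl_part_entry Xp) ->.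
by rewrite -addbA; apply/gen_a_parity/gen_b_parity.
Qed.

Lemma gl_act_mul (F : fieldType) m (g : {mpoly F[m]}) S X Y v :
  gl_act g S X (gl_act g S Y v) = gl_act g S (X *m Y) v +
    \sum_p \sum_q \sum_r \sum_s
      (X p q * Y r s * (-1) ^+ (ipar q && ipar r)) *:
      gen_a g S p (gen_a g S r (gen_b g S q (gen_b g S s v))).
Proof.
have E p q : X p q *: gen_a g S p (gen_b g S q (gl_act g S Y v)) =
    \sum_s (X p q * Y q s) *: gen_a g S p (gen_b g S s v) +
    \sum_r \sum_s (X p q * Y r s * (-1) ^+ (ipar q && ipar r)) *:
      gen_a g S p (gen_a g S r (gen_b g S q (gen_b g S s v))).
  have -> : \sum_s (X p q * Y q s) *: gen_a g S p (gen_b g S s v) =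
      \sum_r \sum_s (X p q * Y r s * (q == r)%:R) *:
        gen_a g S p (gen_b g S s v).
    rewrite [RHS](bigD1 q) //= [X in _ = _ + X]big1 ?addr0.
      by apply: eq_bigr => s _; rewrite eqxx mulr1.
    move=> r /negPf rq; apply: big1 => s _.
    by rewrite eq_sym rq mulr0 scale0r.
  rewrite /gl_act !linear_sum -big_split; apply: eq_bigr => r _ /=.
  rewrite !linear_sum -big_split; apply: eq_bigr => s _ /=.
  rewrite !linearZ /= gen_ba linearD !linearZ /= !scalerDr !scalerA.
  by [].
rewrite {1}/gl_act.
under eq_bigr => p _ do under eq_bigr => q _ do rewrite E.
under eq_bigr => p _ do rewrite big_split.
rewrite big_split; congr (_ + _); apply: eq_bigr => p _.
rewrite exchange_big; apply: eq_bigr => s _.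
by rewrite mxE scaler_suml.
Qed.

Lemma gl_act_bracket (F : fieldType) m (g : {mpoly F[m]}) S p q X Y v :
  X \in sl_part F m p -> Y \in sl_part F m q ->
  gl_act g S (sbracket p q X Y) v =
  gl_act g S X (gl_act g S Y v) -
    (-1) ^+ (p && q) *: gl_act g S Y (gl_act g S X v).
Proof.
move=> Xp Yq; rewrite /sbracket addrC -scaleNr gl_act_linearl !gl_act_mul.
rewrite scalerDr opprD scaleNr addrC addrACA -[LHS]addr0; congr (_ + _).
apply/esym/eqP; rewrite subr_eq0; apply/eqP.
rewrite scaler_sumr; under [RHS]eq_bigr => r _ do rewrite scaler_sumr.
rewrite [RHS]pair_bigA /= [LHS]pair_bigA /=.
under [RHS]eq_bigr => r _ do rewrite pair_bigA scaler_sumr /=.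
under [LHS]eq_bigr => r _ do rewrite pair_bigA /=.
rewrite exchange_big; apply: eq_bigr => -[r s] _; apply: eq_bigr => -[t u] _ /=.
have [->|X0] := eqVneq (X t u) 0; first by rewrite mulr0 !mul0r !scale0r scaler0.
have [->|Y0] := eqVneq (Y r s) 0; first by rewrite mulr0 !mul0r !scale0r scaler0.
have hp : ipar t (+) ipar u = p.
  by apply/eqP; apply: contraNT X0 => /(sl_part_entry Xp) ->.
have hq : ipar r (+) ipar s = q.
  by apply/eqP; apply: contraNT Y0 => /(sl_part_entry Yq) ->.
rewrite gen_aa gen_bb !linearZ /= !scalerA; congr (_ *: _).
rewrite [Y r s * _]mulrC -hp -hq.
by case: (ipar t); case: (ipar u); case: (ipar r); case: (ipar s);
  rewrite /= ?expr0 ?expr1; ring.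
Qed.

Lemma supertrace_bracket (F : fieldType) m p q (X Y : 'M[F]_(m + 1)) :
  X \in sl_part F m p -> Y \in sl_part F m q ->
  supertrace (sbracket p q X Y) = 0.
Proof.
have E (Z T : 'M[F]_(m + 1)) :
    supertrace (Z *m T) = \sum_r \sum_s (-1) ^+ ipar r * Z r s * T s r.
  rewrite /supertrace big_ix ipar_bar mxE -sumrN; congr (_ + _).
    apply: eq_bigr => i _; rewrite mxE; apply: eq_bigr => s _.
    by rewrite ipar_ix mul1r.
  by apply: eq_bigr => s _; rewrite expr1 mulN1r mulNr.
move=> Xp Yq; rewrite /sbracket linearB linearZ /= !E.
apply/eqP; rewrite subr_eq0; apply/eqP.
rewrite scaler_sumr exchange_big; apply: eq_bigr => s _ /=.
rewrite scaler_sumr; apply: eq_bigr => r _ /=.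
have [->|X0] := eqVneq (X r s) 0; first by rewrite !(mulr0, mul0r) scaler0.
have [->|Y0] := eqVneq (Y s r) 0; first by rewrite !(mulr0, mul0r) scaler0.
have <- : ipar r (+) ipar s = p.
  by apply/eqP; apply: contraNT X0 => /(sl_part_entry Xp) ->.
have <- : ipar s (+) ipar r = q.
  by apply/eqP; apply: contraNT Y0 => /(sl_part_entry Yq) ->.
rewrite /GRing.scale /=.
by case: (ipar r); case: (ipar s); rewrite /= ?expr0 ?expr1; ring.
Qed.

Lemma exp_act_linear (F : fieldType) m (g : {mpoly F[m]}) S X :
  X \in sl F m -> linear (exp_act g S X).
Proof.
by move=> /sl_supertrace X0 c u v; rewrite !exp_actE // gl_act_linear.
Qed.

Lemma exp_act_linearl (F : fieldType) m (g : {mpoly F[m]}) S c X Y v :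
  X \in sl F m -> Y \in sl F m ->
  exp_act g S (c *: X + Y) v = c *: exp_act g S X v + exp_act g S Y v.
Proof.
move=> Xs Ys; rewrite !exp_actE ?gl_act_linearl // sl_supertrace //.
by rewrite memvD // memvZ.
Qed.

Lemma exp_act_homog (F : fieldType) m (g : {mpoly F[m]}) S p q X v :
  X \in sl_part F m p -> has_parity q v ->
  has_parity (p (+) q) (exp_act g S X v).
Proof.
move=> Xp vq; rewrite exp_actE; last exact: sl_part_supertrace Xp.
exact: gl_act_parity.
Qed.

Lemma exp_act_bracket (F : fieldType) m (g : {mpoly F[m]}) S p q X Y v :
  X \in sl_part F m p -> Y \in sl_part F m q ->
  exp_act g S (sbracket p q X Y) v =
  exp_act g S X (exp_act g S Y v) -
    (-1) ^+ (p && q) *: exp_act g S Y (exp_act g S X v).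
Proof.
move=> Xp Yq; have X0 := sl_part_supertrace Xp; have Y0 := sl_part_supertrace Yq.
by rewrite !exp_actE ?(supertrace_bracket Xp Yq) ?gl_act_bracket.
Qed.

Lemma exp_act_h (F : fieldType) m (g : {mpoly F[m]}) S i v :
  exp_act g S (sl_h F i) v = exp_h g S i v.
Proof.
rewrite /exp_act (bigD1 i) //= !big1 ?addr0.
- by rewrite !mxE !eqxx ix_bar addr0 scale1r.
- by move=> k _; rewrite !mxE !ix_bar !bar_ix andbF addr0 scale0r.
- by move=> k _; rewrite !mxE !ix_bar !bar_ix andbF addr0 scale0r.
- move=> k _; apply: big1 => l lk; rewrite !mxE !ix_eq ix_bar addr0.
  by case: eqP => [<-|]; rewrite ?(negPf lk) scale0r.
- by move=> k /negPf ki; rewrite !mxE ix_eq ki ix_bar addr0 scale0r.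
Qed.

Lemma exp_act_e (F : fieldType) m (g : {mpoly F[m]}) S i j v : i != j ->
  exp_act g S (delta_mx (ix i) (ix j)) v = exp_e g S i j v.
Proof.
move=> ij; have ji : j != i by rewrite eq_sym.
rewrite /exp_act [X in _ + X + _ + _](bigD1 i) //=.
rewrite [X in _ + (_ + X) + _ + _]big1.
  rewrite [X in _ + (X + _) + _ + _](bigD1 j) /= ?ji // !big1 ?addr0 ?add0r.
  - by rewrite !mxE !eqxx scale1r.
  - by move=> k _; rewrite !mxE bar_ix scale0r.
  - by move=> k _; rewrite !mxE bar_ix andbF scale0r.
  - by move=> k /andP[_ /negPf kj]; rewrite !mxE !ix_eq kj andbF scale0r.
  - move=> k _; rewrite !mxE !ix_eq.
    by case: eqP => [->|]; rewrite ?(negPf ij) scale0r.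
move=> k /negPf ki; apply: big1 => l _.
by rewrite !mxE !ix_eq ki scale0r.
Qed.

Lemma exp_act_ebar (F : fieldType) m (g : {mpoly F[m]}) S i v :
  exp_act g S (delta_mx (ix i) ixbar) v = exp_ebar g S i v.
Proof.
rewrite /exp_act [X in _ + _ + X + _](bigD1 i) //= !big1 ?addr0 ?add0r.
- by rewrite !mxE !eqxx scale1r.
- by move=> k _; rewrite !mxE bar_ix scale0r.
- by move=> k /negPf ki; rewrite !mxE ix_eq ki scale0r.
- by move=> k _; apply: big1 => l _; rewrite !mxE ix_bar andbF scale0r.
- by move=> k _; rewrite !mxE ix_bar andbF scale0r.
Qed.

Lemma exp_act_bare (F : fieldType) m (g : {mpoly F[m]}) S i v :
  exp_act g S (delta_mx ixbar (ix i)) v = exp_bare g S i v.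
Proof.
rewrite /exp_act [X in _ + _ + _ + X](bigD1 i) //= !big1 ?addr0 ?add0r.
- by rewrite !mxE !eqxx scale1r.
- by move=> k /negPf ki; rewrite !mxE ix_eq ki andbF scale0r.
- by move=> k _; rewrite !mxE ix_bar scale0r.
- by move=> k _; apply: big1 => l _; rewrite !mxE ix_bar scale0r.
- by move=> k _; rewrite !mxE ix_bar scale0r.
Qed.

Definition expmod (F : fieldType) m (g : {mpoly F[m]}) (S : {set 'I_m}) :
    sl_module F m :=
  SlModule (@exp_act_linear F m g S) (@exp_act_linearl F m g S)
    (@exp_act_homog F m g S) (@exp_act_bracket F m g S).

Definition Nk m (k : 'I_m -> nat) : {set 'I_m} := [set i | k i == 2].

(* (Z/2Z)^(N(k)), with the pointwise group structure of {ffun _ -> 'Z_2} *)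
Notation Gk k := {ffun {i | i \in Nk k} -> 'Z_2}.

Definition Supp m (k : 'I_m -> nat) (e : Gk k) : {set 'I_m} :=
  [set val j | j : {i | i \in Nk k} & e j == 1].

Definition Gk_act (F : fieldType) m (k : 'I_m -> nat) (e : Gk k)
    (a : 'I_m -> F) (i : 'I_m) : F :=
  if insub i is Some j then
    (- (1 / 4%:R)) ^+ e j * a i ^ (1 - 2 * Posz (e j))
  else a i.

Definition twist (F : fieldType) m (S : {set 'I_m}) (a : 'I_m -> F)
    (i : 'I_m) : F :=
  if i \in S then a i else (a i)^-1.

(* Equality in the weighted projective space P(k) of tuples with nonzero
   coordinates. *)
Definition wproj_eq (F : fieldType) m (k : 'I_m -> nat) (c d : 'I_m -> F) :
    Prop :=
  exists2 l : F, l != 0 & forall i, c i = l ^+ k i * d i.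

(* Main.v *)
From HB Require Import structures.
Require Import Defs.
From mathcomp Require Import all_boot all_order all_algebra.
From mathcomp Require Import ssrcomplements mpoly complex.
From mathcomp Require Import reals.
From mathcomp Require Import ring zify.
From Stdlib Require Import ClassicalEpsilon.
Import Order.TTheory GRing.Theory Num.Theory.
Local Open Scope ring_scope.
Local Open Scope complex_scope.

(** Write A_i for x_i (i outside S) or D_i = d/dx_i + dg/dx_i (i in S), and B_i
    for D_i or - x_i respectively. The odd generators act on E(g, S) through
    A_i, from the odd to the even half, and through B_i, from the even to the
    odd half, and they generate everything else. So an isomorphism from E(g, S1)
    to E(g', S2) is a pair of linear bijections phi_0, phi_1 of C[x] with
      phi_0 A_i = A'_i phi_1   and   phi_1 B_i = B'_i phi_0.

    From the isomorphism to the parameters. The pair extends to a ladder of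
    injective maps phi_n, n in Z, any two neighbours being related in the same
    way ([ladder]). To go up one needs w with A'_i w = phi_1 (A_i f) for all i;
    it exists because two operators A'_i, A'_j with i <> j form a regular
    sequence ([koszul_exact]), and this is where m >= 2 enters. Going down is
    the same construction for B and - A. Put p_n = phi_n 1. Applying the ladder
    to the identity D_i 1 = k_i a_i x_i^(k_i - 1) gives
      k_i a_i P^(k_i - 1) p_(n +- k_i) = Q p_n,
    where P and Q are the operators replacing x_i and D_i ([ladder_vacuum]).
    Each of P, Q is, up to sign, x_i or D'_i, and shifts leading monomials by a
    fixed monomial, so leading terms can be compared. For i in the symmetric
    difference of S1 and S2, degrees give
      (k_i - 1)^2 + deg p_(n +- k_i) = 1 + deg p_n   for all n in Z,
    which forces k_i = 2, as degrees cannot decrease for ever ([ladder_k2]).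
    For every i, leading coefficients nu_n of p_n satisfy
    nu_(n +- k_i) = rho_i nu_n with an explicit ratio rho_i of the parameters
    ([ladder_rho]). By Bezout nu is then multiplicative along shifts by
    d = gcd k_i, and a d-th root mu of that factor solves
    mu^(+- k_i) = rho_i for all i at once ([common_root]).

    From the parameters to the isomorphism. Conversely such a mu yields
    operators P_i, Q_i satisfying the Weyl relations and
    Q_i 1 = k_i a_i P_i^(k_i - 1) 1, hence a linear map phi with phi 1 = 1,
    phi x_i = P_i phi and phi D_i = Q_i phi ([vacuum_map]). It combines a
    rescaling of the variables with Fourier transforms exp(a x^2) ->
    exp(- x^2 / (4 a)) in the variables where S1 and S2 differ. The conditions
    on mu are symmetric, so there is also such a map backwards, and the two are
    inverse because a map commuting with all x_i and fixing 1 is the identity.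
    The pair (phi, mu phi) is the required isomorphism ([compatible_iso]). *)

Set Implicit Arguments.
Unset Strict Implicit.
Unset Printing Implicit Defensive.

(** * The operators on one homogeneous component *)

Definition covd (F : fieldType) m (g : {mpoly F[m]}) (i : 'I_m)
    (f : {mpoly F[m]}) : {mpoly F[m]} := f^`M(i) + f * g^`M(i).

Definition raise (F : fieldType) m (g : {mpoly F[m]}) (S : {set 'I_m})
    (i : 'I_m) (f : {mpoly F[m]}) : {mpoly F[m]} :=
  if i \in S then covd g i f else 'X_i * f.

Definition lower (F : fieldType) m (g : {mpoly F[m]}) (S : {set 'I_m})
    (i : 'I_m) (f : {mpoly F[m]}) : {mpoly F[m]} :=
  if i \in S then - ('X_i * f) else covd g i f.

(** The maps of a ladder are obtained by choice, and come as functions with a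
    proof of linearity. *)
Section LinearProp.
Variables (F : fieldType) (V W : lmodType F) (P : V -> W).
Hypothesis linP : linear P.

Lemma linear_prop0 : P 0 = 0.
Proof. by have := linP (-1) 0 0; rewrite scaler0 add0r scaleN1r addNr. Qed.

Lemma linear_propZ c u : P (c *: u) = c *: P u.
Proof. by rewrite -[c *: u]addr0 linP linear_prop0 addr0. Qed.

Lemma linear_propN u : P (- u) = - P u.
Proof. by rewrite -scaleN1r linear_propZ scaleN1r. Qed.

Lemma linear_propD u v : P (u + v) = P u + P v.
Proof. by rewrite -[u]scale1r linP !scale1r. Qed.

Lemma linear_propB u v : P (u - v) = P u - P v.
Proof. by rewrite linear_propD linear_propN. Qed.

End LinearProp.

Section Operators.
Variables (F : fieldType) (m : nat).
Implicit Types (f g : {mpoly F[m]}) (S : {set 'I_m}) (i j : 'I_m).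

Lemma covd_linear g i : linear (covd g i).
Proof.
by move=> c u v; rewrite /covd linearP /= mulrDl scalerDr scalerAl addrACA.
Qed.

Lemma raise_linear g S i : linear (raise g S i).
Proof.
move=> c u v; rewrite /raise; case: ifP => _; first exact: covd_linear.
by rewrite /= mulrDr -scalerAr.
Qed.

Lemma lower_linear g S i : linear (lower g S i).
Proof.
move=> c u v; rewrite /lower; case: ifP => _; last exact: covd_linear.
by rewrite /= mulrDr opprD -scalerAr scalerN.
Qed.

Lemma gen_a_ixE g S i (v : expvec F m) :
  gen_a g S (ix i) v = (raise g S i v.1, raise g S i v.2).
Proof. by rewrite gen_a_ix /raise; case: ifP. Qed.

Lemma gen_b_ixE g S i (v : expvec F m) :
  gen_b g S (ix i) v = (lower g S i v.1, lower g S i v.2).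
Proof. by rewrite gen_b_ix /lower; case: ifP. Qed.

Lemma raiseC g S i j f :
  raise g S i (raise g S j f) = raise g S j (raise g S i f).
Proof.
have /= := congr1 fst (gen_aa g S (ix i) (ix j) (f, 0)).
by rewrite !gen_a_ixE ipar_ix /= expr0 scale1r.
Qed.

Lemma lowerC g S i j f :
  lower g S i (lower g S j f) = lower g S j (lower g S i f).
Proof.
have /= := congr1 fst (gen_bb g S (ix i) (ix j) (f, 0)).
by rewrite !gen_b_ixE ipar_ix /= expr0 scale1r.
Qed.

Lemma lower_raise g S i j f :
  lower g S j (raise g S i f) = (j == i)%:R *: f + raise g S i (lower g S j f).
Proof.
have /= := congr1 fst (gen_ba g S (ix j) (ix i) (f, 0)).
by rewrite gen_a_ixE !gen_b_ixE gen_a_ixE !ipar_ix ix_eq /= expr0 scale1r.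
Qed.

End Operators.

(** * Leading monomials *)

(** Leading terms are taken for the degree-lexicographic order; [P] multiplies
    the leading term of every nonzero polynomial by the same term. *)
Definition shifts_lead (F : fieldType) m (P : {mpoly F[m]} -> {mpoly F[m]})
    (e : 'X_{1..m}) (c : F) : Prop :=
  c != 0 /\ forall f, f != 0 ->
    mlead (P f) = (e + mlead f)%MM /\ mleadc (P f) = c * mleadc f.

Section Lead.
Variables (F : fieldType) (m : nat).
Implicit Types (f p q : {mpoly F[m]}) (P Q : {mpoly F[m]} -> {mpoly F[m]}).

Lemma shifts_lead_neq0 P e c f : shifts_lead P e c -> f != 0 -> P f != 0.
Proof.
case=> c0 h f0; have [_ hc] := h _ f0.
by rewrite -mleadc_eq0 hc mulf_neq0 // mleadc_eq0.
Qed.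

Lemma shifts_lead_inj P e c : linear P -> shifts_lead P e c -> injective P.
Proof.
move=> linP hP u v uv; apply/eqP; rewrite -subr_eq0; apply/negPn/negP.
move/(shifts_lead_neq0 hP).
by rewrite (linear_propB linP) uv subrr eqxx.
Qed.

Lemma shifts_leadN P e c :
  shifts_lead P e c -> shifts_lead (fun f => - P f) e (- c).
Proof.
case=> c0 h; split=> [|f f0]; first by rewrite oppr_eq0.
by have [h1 h2] := h _ f0; rewrite mleadN mcoeffN h1 mulNr -h2 h1.
Qed.

Lemma shifts_lead_iter P e c n f : shifts_lead P e c -> f != 0 ->
  [/\ iter n P f != 0, mlead (iter n P f) = (e *+ n + mlead f)%MM &
      mleadc (iter n P f) = c ^+ n * mleadc f].
Proof.
move=> hP f0; elim: n => [|n [IH0 IH1 IH2]] /=.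
  by rewrite mulm0n add0m expr0 mul1r.
have [h1 h2] := hP.2 _ IH0; split; first exact: shifts_lead_neq0 hP IH0.
- by rewrite h1 IH1 mulmS addmA.
- by rewrite h2 IH2 exprS mulrA.
Qed.

Lemma mulX_lead (i : 'I_m) : shifts_lead (fun f : {mpoly F[m]} => 'X_i * f) U_(i) 1.
Proof.
split=> [|f f0]; first exact: oner_neq0.
have X0 : 'X_i != 0 :> {mpoly F[m]}.
  by rewrite -mleadc_eq0 mleadXm mcoeffX eqxx oner_neq0.
have h : mlead ('X_i * f) = (U_(i) + mlead f)%MM by rewrite mleadM // mleadXm.
rewrite h; split=> //.
by rewrite -{1}(mleadXm F U_(i)) mleadcM mleadXm mcoeffX eqxx.
Qed.

Lemma mlead_mderiv i p : p^`M(i) != 0 -> (mlead p^`M(i) < mlead p)%O.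
Proof.
move=> p'0; have : p^`M(i)@_(mlead p^`M(i)) != 0 by rewrite mleadc_eq0.
rewrite mcoeff_deriv => h.
have : (mlead p^`M(i) + U_(i))%MM \in msupp p.
  by rewrite mcoeff_msupp; apply: contraNneq h => ->; rewrite mul0rn.
move/msupp_le_mlead; apply: lt_le_trans.
by apply: lt_mdeg_ltmc; rewrite mdegD mdeg1 addn1.
Qed.

(** Differentiation lowers the degree, so that multiplication by the derivative
    of [g] decides, even when that derivative is a constant. *)
Lemma covd_lead (g : {mpoly F[m]}) i c d : c != 0 -> g^`M(i) = c *: 'X_i ^+ d ->
  shifts_lead (covd g i) (U_(i) *+ d) c.
Proof.
move=> c0 gE; split=> // f f0; rewrite /covd gE.
have q0 : c *: 'X_i ^+ d != 0 :> {mpoly F[m]}.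
  by rewrite mpolyXn -mleadc_eq0 mleadcZE mleadXm mcoeffX eqxx mulr1.
have qm : mlead (c *: 'X_i ^+ d : {mpoly F[m]}) = (U_(i) *+ d)%MM.
  by rewrite mleadZ // mpolyXn mleadXm.
have h : mlead (f * (c *: 'X_i ^+ d)) = (U_(i) *+ d + mlead f)%MM.
  by rewrite mleadM // qm addmC.
have hc : mleadc (f * (c *: 'X_i ^+ d)) = c * mleadc f.
  rewrite h addmC -qm mleadcM mulrC; congr (_ * _).
  by rewrite mleadcZE mpolyXn mleadXm mcoeffX eqxx mulr1.
have [->|f'0] := eqVneq f^`M(i) 0; first by rewrite add0r.
have lt : (mlead f^`M(i) < mlead (f * (c *: 'X_i ^+ d)))%O.
  by rewrite h (lt_le_trans (mlead_mderiv f'0)) // lemc_addl.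
by rewrite mleadDr // h; split=> //; rewrite mcoeffD -h hc mcoeff_gt_mlead // add0r.
Qed.

Lemma mlead_subr_lt p q : mlead p = mlead q -> mleadc p = mleadc q ->
  p - q != 0 -> (mlead (p - q) < mlead p)%O.
Proof.
move=> pq cpq pq0; have := mleadB_le p q; rewrite -pq joinxx le_eqVlt.
case/predU1P => // E; case/negP: pq0; rewrite -mleadc_eq0 E mcoeffB cpq pq.
by rewrite subrr.
Qed.

(** [P] and [Q] form a regular sequence. By disjointness of [e] and [e'] the
    leading monomial of [v] is divisible by [e], so a monomial [w0] can be found
    such that [P w0] cancels the leading term of [v]; then [P (u - Q w0) =
    Q (v - P w0)] is an equation of the same kind with a smaller [v]. *)
Lemma koszul_exact P Q e e' c c' u v :
    linear P -> linear Q -> (forall f, P (Q f) = Q (P f)) ->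
    shifts_lead P e c -> shifts_lead Q e' c' ->
    (forall i, (e i == 0%N) || (e' i == 0%N)) ->
    P u = Q v -> exists2 w, u = Q w & v = P w.
Proof.
move=> linP linQ PQC hP hQ disj.
have injP := shifts_lead_inj linP hP.
elim/mleadrect: v u => v IH u Puv.
have [v0|v0] := eqVneq v 0.
  exists 0; last by rewrite v0 (linear_prop0 linP).
  by apply: injP; rewrite Puv v0 !(linear_prop0 linQ) (linear_prop0 linP).
have u0 : u != 0.
  apply: contraNneq (shifts_lead_neq0 hQ v0) => u0.
  by rewrite -Puv u0 (linear_prop0 linP).
have E : (e + mlead u = e' + mlead v)%MM.
  by rewrite -(hP.2 _ u0).1 Puv (hQ.2 _ v0).1.
have ev : (e <= mlead v)%MM.
  apply/mnm_lepP => i; have /mnmP/(_ i) := E; rewrite !mnmDE.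
  by case/orP: (disj i) => /eqP ->; rewrite // add0n => <-; apply: leq_addr.
pose w0 := (mleadc v / c) *: 'X_[mlead v - e] : {mpoly F[m]}.
have vc0 : mleadc v / c != 0 by rewrite mulf_neq0 ?invr_eq0 ?hP.1 ?mleadc_eq0.
have w00 : w0 != 0.
  by rewrite -mleadc_eq0 mleadcZE mleadXm mcoeffX eqxx mulr1.
have wm : mlead w0 = (mlead v - e)%MM by rewrite mleadZ // mleadXm.
have [h1 h2] := hP.2 _ w00.
have lv : mlead v = mlead (P w0) by rewrite h1 wm addmC submK.
have lc : mleadc v = mleadc (P w0).
  rewrite h2 mleadcZE mleadXm mcoeffX eqxx mulr1 mulrC divfK //; exact: hP.1.
have Puv' : P (u - Q w0) = Q (v - P w0).
  by rewrite (linear_propB linP) (linear_propB linQ) Puv PQC.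
have [vz|vz] := eqVneq (v - P w0) 0.
  exists w0; apply/eqP; rewrite -subr_eq0; last by rewrite vz.
  by apply/eqP/injP; rewrite Puv' vz (linear_prop0 linP) (linear_prop0 linQ).
have [w hu hv] := IH _ (mlead_subr_lt lv lc vz) _ Puv'.
exists (w + w0).
- by rewrite (linear_propD linQ) -hu subrK.
- by rewrite (linear_propD linP) -hv subrK.
Qed.

End Lead.

(** * Chains indexed by the integers *)

Lemma nat_chain (T : Type) (R : T -> T -> Prop) x0 x1 :
  (forall x y, R x y -> exists z, R y z) -> R x0 x1 ->
  exists f : nat -> T, [/\ f 0%N = x0, f 1%N = x1 & forall n, R (f n) (f n.+1)].
Proof.
move=> next R01.
pose step (p : T * T) := (p.2, epsilon (inhabits x0) (R p.2)).
pose p n := iter n step (x0, x1).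
have hp n : R (p n).1 (p n).2.
  by elim: n => //= n /next; apply: epsilon_spec.
by exists (fun n => (p n).1); split => // n; apply: hp.
Qed.

Lemma int_chain (T : Type) (R : T -> T -> Prop) x0 x1 :
  (forall x y, R x y -> exists z, R y z) ->
  (forall x y, R x y -> exists z, R z x) -> R x0 x1 ->
  exists f : int -> T, forall n, R (f n) (f (n + 1)).
Proof.
move=> next prev R01.
have [u [u0 u1 hu]] := nat_chain next R01.
have [d [d0 d1 hd]] := nat_chain (R := fun x y => R y x) (fun x y => @prev y x) R01.
exists (fun n => match n with Posz k => u k | Negz k => d k.+2 end) => -[n|[|n]].
- by rewrite -PoszD addn1.
- by rewrite /= u0 -d1; apply: hd.
- have -> : Negz n.+1 + 1 = Negz n by rewrite !NegzE -addn1 PoszD opprD addrNK.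
  exact: hd.
Qed.

(** * Ladders of intertwiners *)

(** The part of the properties of the operators A_i, B_i that the construction
    uses. It also holds for B_i, - A_i, which turns the downward step into an
    upward one. *)
Definition weyl (F : fieldType) m
    (A B : 'I_m -> {mpoly F[m]} -> {mpoly F[m]}) : Prop :=
  [/\ forall i, linear (A i), forall i j f, A i (A j f) = A j (A i f),
      forall i j f, B j (A i f) = (j == i)%:R *: f + A i (B j f) &
      forall i, exists d c, shifts_lead (A i) (U_(i) *+ d)%MM c].

Definition linked (F : fieldType) m
    (A B A' B' : 'I_m -> {mpoly F[m]} -> {mpoly F[m]})
    (phi psi : {mpoly F[m]} -> {mpoly F[m]}) : Prop :=
  [/\ linear phi /\ injective phi, linear psi /\ injective psi,
      forall i f, phi (A i f) = A' i (psi f) &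
      forall i f, psi (B i f) = B' i (phi f)].

Section Ladder.
Variables (F : fieldType) (m : nat).
Implicit Types A B : 'I_m -> {mpoly F[m]} -> {mpoly F[m]}.

Lemma weyl_swap A B : weyl A B -> (forall i, linear (B i)) ->
  (forall i j f, B i (B j f) = B j (B i f)) ->
  (forall i, exists d c, shifts_lead (B i) (U_(i) *+ d)%MM c) ->
  weyl B (fun i f => - A i f).
Proof.
case=> _ _ BA _ linB BC leadB; split=> // i j f.
by rewrite (linear_propN (linB i)) BA opprD addrA eq_sym subrr add0r.
Qed.

(** The upward step. The values [psi (A i f)] form a cocycle,
    [A' j (psi (A i f)) = A' i (psi (A j f))], since both sides are
    [phi (A j (A i f))]; exactness for two indices provides [chi f], and
    injectivity of the [A' i] does the rest. *)
Lemma linked_next A B A' B' phi psi : (1 < m)%N -> weyl A B -> weyl A' B' ->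
  (forall i, linear (B' i)) ->
  linked A B A' B' phi psi -> exists chi, linked A B A' B' psi chi.
Proof.
move=> m1 [linA AC BA leadA] [linA' AC' BA' leadA'] linB'.
case=> -[linphi injphi] [linpsi injpsi] phiA psiB.
have injA' i : injective (A' i).
  by have [d [c h]] := leadA' i; apply: (shifts_lead_inj (linA' i) h).
have ex f : exists w, forall i, psi (A i f) = A' i w.
  pose i0 := Ordinal (ltnW m1); pose i1 := Ordinal m1.
  have [d0 [c0 l0]] := leadA' i0; have [d1 [c1 l1]] := leadA' i1.
  have E i j : A' j (psi (A i f)) = A' i (psi (A j f)).
    by rewrite -!phiA AC.
  have disj l : ((U_(i1) *+ d1)%MM l == 0%N) || ((U_(i0) *+ d0)%MM l == 0%N).
    rewrite !mulmnE !mnm1E; case: (eqVneq i1 l) => [<-|_]; last by rewrite eqxx.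
    by rewrite orbC.
  have [w h0 h1] := koszul_exact (linA' i1) (linA' i0) (AC' i1 i0)
    l1 l0 disj (E i0 i1).
  by exists w => i; apply: (injA' i0); rewrite -E h0 AC'.
have [chi hchi] : exists chi, forall f i, psi (A i f) = A' i (chi f).
  exists (fun f => epsilon (inhabits 0) (fun w =>
    forall i, psi (A i f) = A' i w)) => f;
    exact: (epsilon_spec (inhabits 0) _ (ex f)).
pose i0 := Ordinal (ltnW m1).
exists chi; split=> //.
- split=> [c u v|u v uv].
    by apply: (injA' i0); rewrite linA' -!hchi linA linpsi.
  have [d [c h]] := leadA i0; apply: (shifts_lead_inj (linA i0) h).
  by apply: injpsi; rewrite !hchi uv.
- move=> j f; apply: (injA' i0).
  have -> : A' i0 (chi (B j f)) = psi (B j (A i0 f)) - (j == i0)%:R *: psi f.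
    rewrite -hchi BA (linear_propD linpsi) (linear_propZ linpsi).
    by rewrite addrAC subrr add0r.
  by rewrite psiB phiA BA' addrAC subrr add0r.
Qed.

Lemma linked_swap A B A' B' phi psi :
  (forall i, linear (A' i)) -> linked A B A' B' phi psi ->
  linked B (fun i f => - A i f) B' (fun i f => - A' i f) psi phi.
Proof.
move=> linA' [hphi hpsi hA hB]; split=> // i f.
by rewrite (linear_propN hphi.1) hA.
Qed.

Lemma ladder A B A' B' phi psi : (1 < m)%N -> weyl A B -> weyl A' B' ->
  weyl B (fun i f => - A i f) -> weyl B' (fun i f => - A' i f) ->
  linked A B A' B' phi psi ->
  exists Phi : int -> {mpoly F[m]} -> {mpoly F[m]},
    forall n, linked A B A' B' (Phi n) (Phi (n + 1)).
Proof.
move=> m1 wA wA' wB wB' start.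
have linB' i : linear (B' i) by case: wB' => h _ _ _; apply: h.
have linA' i : linear (A' i) by case: wA' => h _ _ _; apply: h.
have linA i : linear (A i) by case: wA => h _ _ _; apply: h.
apply: int_chain start => x y; first exact: linked_next.
move=> /(linked_swap linA') xy.
have linNA' i : linear (fun f => - A' i f).
  by move=> c u v; rewrite linA' opprD scalerN.
have [z [hy hz h1 h2]] := linked_next m1 wB wB' linNA' xy.
exists z; split=> // i f.
by apply: oppr_inj; rewrite -h2 (linear_propN hz.1).
Qed.

End Ladder.

(** * Multiplicative sequences on the integers *)

Lemma no_int_descent (d : int -> nat) (t : int) :
  ~ (forall n, (d (n + t)%R < d n)%N).
Proof.
move=> h.
have bound N : forall n, (N <= d n)%N.
  elim: N => // N IH n; exact: leq_ltn_trans (IH _) (h n).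
by have := bound (d 0).+1 0; rewrite ltnn.
Qed.

Section MultShift.
Variables (F : fieldType) (nu : int -> F).
Hypothesis nu_neq0 : forall n, nu n != 0.

Definition mult_shift (t : int) (eta : F) : Prop :=
  forall n, nu (n + t) = eta * nu n.

Lemma mult_shift_neq0 t eta : mult_shift t eta -> eta != 0.
Proof.
by move=> /(_ 0) h; apply: contraNneq (nu_neq0 (0 + t)) => e0; rewrite h e0 mul0r.
Qed.

Lemma mult_shift_inj t eta eta' :
  mult_shift t eta -> mult_shift t eta' -> eta = eta'.
Proof. by move=> /(_ 0) h /(_ 0); rewrite h => /(mulIf (nu_neq0 0)). Qed.

Lemma mult_shiftD t t' eta eta' :
  mult_shift t eta -> mult_shift t' eta' -> mult_shift (t + t') (eta * eta').
Proof. by move=> h h' n; rewrite addrA h' h mulrCA mulrA. Qed.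

Lemma mult_shiftN t eta : mult_shift t eta -> mult_shift (- t) eta^-1.
Proof.
move=> h n; rewrite -[in RHS](subrK t n) h mulKf //; exact: mult_shift_neq0 h.
Qed.

Lemma mult_shiftM t eta (q : int) :
  mult_shift t eta -> mult_shift (t * q) (eta ^ q).
Proof.
move=> h; have hn (k : nat) : mult_shift (t * k%:Z) (eta ^+ k).
  elim: k => [|k IH]; first by move=> n; rewrite mulr0 addr0 mul1r.
  by rewrite exprSr -addn1 PoszD mulrDr mulr1; apply: mult_shiftD.
by case: q => k; [exact: hn | rewrite NegzE mulrN; exact/mult_shiftN/hn].
Qed.

Lemma mult_shift_gcdn (a b : nat) eta eta' :
  mult_shift a eta -> mult_shift b eta' ->
  exists eta'', mult_shift (gcdn a b) eta''.
Proof.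
move=> ha hb; have [u [v uv]] := Bezoutz a b.
have -> : Posz (gcdn a b) = a%:Z * u + b%:Z * v by rewrite mulrC [b%:Z * v]mulrC uv.
by exists (eta ^ u * eta' ^ v); apply: mult_shiftD; apply: mult_shiftM.
Qed.

End MultShift.

(** By Bezout the sequence is multiplicative along the shift by the gcd [d] of
    the [t i]; the root of order [d] of the factor serves for all [i], whereas
    roots extracted separately for each [i] need not agree. *)
Lemma common_root (C : numClosedFieldType) m (nu : int -> C) (t : 'I_m -> int)
    (rho : 'I_m -> C) : (0 < m)%N -> (forall n, nu n != 0) ->
  (forall i, t i != 0) -> (forall i, mult_shift nu (t i) (rho i)) ->
  exists2 mu, mu != 0 & forall i, mu ^ t i = rho i.
Proof.
move=> m0 nu0 t0 ht; pose d := (\big[gcdn/0]_i `|t i|)%N.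
have d0 : (0 < d)%N.
  rewrite lt0n; apply: contra (t0 (Ordinal m0)) => /eqP d0.
  have : (d %| `|t (Ordinal m0)|)%N by apply: (biggcdn_inf (Ordinal m0)).
  by rewrite d0 dvd0n absz_eq0.
have [eta heta] : exists eta, mult_shift nu d eta.
  rewrite /d; elim/big_ind: _ => [|a b [eta ha] [eta' hb]|i _].
  - by exists 1 => n; rewrite addr0 mul1r.
  - exact: (mult_shift_gcdn nu0 ha hb).
  - have [->|->] : (`|t i|%N = t i :> int) \/ (`|t i|%N = - t i :> int) by lia.
      by exists (rho i).
    by exists (rho i)^-1; apply: mult_shiftN.
have rE : (d.-root eta) ^+ d = eta by rewrite rootCK.
exists (d.-root eta).
  apply: contraNneq (mult_shift_neq0 nu0 heta) => r0.
  by rewrite -rE r0 expr0n gtn_eqF.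
move=> i; apply: (mult_shift_inj nu0 _ (ht i)).
have /dvdzP[q ->] : (d %| t i)%Z by apply: (biggcdn_inf i).
by rewrite mulrC -exprz_exp -exprnP rE; apply: mult_shiftM.
Qed.

(** * Exponential modules of sums of powers *)

Definition potential (F : fieldType) m (a : 'I_m -> F) (k : 'I_m -> nat) :
  {mpoly F[m]} := \sum_(i < m) a i *: 'X_i ^+ k i.

Lemma mderiv_potential (F : fieldType) m (a : 'I_m -> F) (k : 'I_m -> nat) i :
  (potential a k)^`M(i) = (a i * (k i)%:R) *: 'X_i ^+ (k i).-1.
Proof.
rewrite /potential linear_sum (bigD1 i) //= big1 ?addr0 => [|j ji];
  rewrite mderivZ mpolyXn mderivX mulmnE mnm1E.
  rewrite eqxx mul1n scalerA mpolyXn; have [->|k0] := posnP (k i).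
    by rewrite mulr0 !scale0r.
  congr (_ *: 'X_[_]); apply/mnmP => l; rewrite mnmBE !mulmnE.
  by case: (k i) k0 => // n _; rewrite mulnS addnC addnK.
by rewrite (negPf ji) mul0n scale0r scaler0.
Qed.

(** [imX] and [imD] are what multiplication by x_i and [covd] become under an
    intertwiner from a module with set [S1] to the module with set [S2]: on the
    source x_i is A_i or - B_i, and D_i is B_i or A_i, according to [S1]. *)
Definition imX (F : fieldType) m (g : {mpoly F[m]}) (S1 S2 : {set 'I_m}) i f :=
  if i \in S1 then - lower g S2 i f else raise g S2 i f.

Definition imD (F : fieldType) m (g : {mpoly F[m]}) (S1 S2 : {set 'I_m}) i f :=
  if i \in S1 then raise g S2 i f else lower g S2 i f.

(** x_i moves up the ladder by [sgS S i] steps. *)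
Definition sgS m (S : {set 'I_m}) (i : 'I_m) : int := if i \in S then -1 else 1.

(** The Fourier transform replaces a_i by - 1 / (4 a_i); in both cases this is
    b_i divided by the parameter obtained from a_i. *)
Definition rho (F : fieldType) m (S1 S2 : {set 'I_m}) (a b : 'I_m -> F) i : F :=
  if (i \in S1) (+) (i \in S2) then - (4%:R * a i * b i) else b i / a i.

(** [mu] is the factor between the even and the odd half of an isomorphism,
    equivalently the coordinate change in the weighted projective space. *)
Definition compatible (F : fieldType) m (S1 S2 : {set 'I_m}) (a b : 'I_m -> F)
    (k : 'I_m -> nat) (mu : F) : Prop :=
  forall i, ((i \in S1) (+) (i \in S2) -> k i = 2%N) /\
            mu ^ (sgS S2 i * (k i)%:Z) = rho S1 S2 a b i.

Section Potential.
Variables (F : numFieldType) (m : nat) (k : 'I_m -> nat).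
Hypothesis k_gt0 : forall i, (0 < k i)%N.
Implicit Types (a b : 'I_m -> F) (S : {set 'I_m}).

Lemma slope_neq0 a i : a i != 0 -> a i * (k i)%:R != 0.
Proof. by move=> a0; rewrite mulf_neq0 // pnatr_eq0 -lt0n. Qed.

Lemma covd_potential_lead a i : a i != 0 ->
  shifts_lead (covd (potential a k) i) (U_(i) *+ (k i).-1)%MM (a i * (k i)%:R).
Proof. by move=> a0; apply: covd_lead; rewrite ?slope_neq0 ?mderiv_potential. Qed.

Lemma mulX1_lead i :
  shifts_lead (fun f : {mpoly F[m]} => 'X_i * f) (U_(i) *+ 1)%MM 1.
Proof. by rewrite mulm1n; apply: mulX_lead. Qed.

Lemma raise_lead a S i : a i != 0 -> shifts_lead (raise (potential a k) S i)
  (U_(i) *+ (if i \in S then (k i).-1 else 1%N))%MM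
  (if i \in S then a i * (k i)%:R else 1).
Proof.
move=> a0; rewrite /raise.
by case: ifP => _; [exact: covd_potential_lead | exact: mulX1_lead].
Qed.

Lemma lower_lead a S i : a i != 0 -> shifts_lead (lower (potential a k) S i)
  (U_(i) *+ (if i \in S then 1%N else (k i).-1))%MM
  (if i \in S then - 1 else a i * (k i)%:R).
Proof.
move=> a0; rewrite /lower.
by case: ifP => _; [exact: shifts_leadN (mulX1_lead i)|exact: covd_potential_lead].
Qed.

Lemma weyl_raise a S : (forall i, a i != 0) ->
  weyl (raise (potential a k) S) (lower (potential a k) S).
Proof.
move=> a0; split=> [i|i j f|i j f|i]; first exact: raise_linear.
- exact: raiseC.
- exact: lower_raise.
- by do 2 eexists; apply: raise_lead.
Qed.

Lemma weyl_lower a S : (forall i, a i != 0) ->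
  weyl (lower (potential a k) S) (fun i f => - raise (potential a k) S i f).
Proof.
move=> a0; apply: weyl_swap => [|i|i j f|i]; first exact: weyl_raise.
- exact: lower_linear.
- exact: lowerC.
- by do 2 eexists; apply: lower_lead.
Qed.

End Potential.

(** * From an isomorphism to the parameters *)

Section FromIso.
Variables (F : fieldType) (m : nat).
Implicit Types (g : {mpoly F[m]}) (S : {set 'I_m}).

Lemma delta_ix_bar_sl i : delta_mx (ix i) ixbar \in sl F m.
Proof.
apply: (@sl_part_sub F m true); rewrite /sl_part memv_span // mem_cat.
by apply/orP; left; apply: image_f.
Qed.

Lemma delta_bar_ix_sl i : delta_mx ixbar (ix i) \in sl F m.
Proof.
apply: (@sl_part_sub F m true); rewrite /sl_part memv_span // mem_cat.
by apply/orP; right; apply: image_f.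
Qed.

Lemma exp_act_raise g S i f :
  exp_act g S (delta_mx (ix i) ixbar) (0, f) = (raise g S i f, 0).
Proof.
rewrite exp_act_ebar /exp_ebar /raise.
by case: ifP => _; apply: expvec_eq; rewrite //= ?mulr0 ?mderiv0 ?mul0r ?addr0.
Qed.

Lemma exp_act_lower g S i f :
  exp_act g S (delta_mx ixbar (ix i)) (f, 0) = (0, lower g S i f).
Proof.
rewrite exp_act_bare /exp_bare /lower.
by case: ifP => _; apply: expvec_eq; rewrite //= ?mulr0 ?oppr0
  ?mderiv0 ?mul0r ?addr0.
Qed.

Lemma iso_linked g g' S1 S2 : sl_iso (expmod g S1) (expmod g' S2) ->
  exists phi psi,
    linked (raise g S1) (lower g S1) (raise g' S2) (lower g' S2) phi psi.
Proof.
case=> Phi [/bij_inj injPhi parPhi actPhi].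
pose phi (f : {mpoly F[m]}) : {mpoly F[m]} := (Phi (f, 0)).1.
pose psi (f : {mpoly F[m]}) : {mpoly F[m]} := (Phi (0, f)).2.
have evE f : Phi (f, 0) = (phi f, 0).
  apply: expvec_eq => //=; exact: (parPhi false).
have oddE f : Phi (0, f) = (0, psi f).
  apply: expvec_eq => //=; exact: (parPhi true).
have addE c (u v : {mpoly F[m]}) :
    (c *: u + v, 0) = c *: (u, 0) + (v, 0) :> expvec F m.
  by apply: expvec_eq; rewrite /= ?scaler0 ?addr0.
have addO c (u v : {mpoly F[m]}) :
    (0, c *: u + v) = c *: (0, u) + (0, v) :> expvec F m.
  by apply: expvec_eq; rewrite /= ?scaler0 ?addr0.
exists phi, psi; split.
- split=> [c u v|u v uv]; first by rewrite /phi addE (linearP Phi).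
  by have /injPhi[] : Phi (u, 0) = Phi (v, 0) by rewrite !evE uv.
- split=> [c u v|u v uv]; first by rewrite /psi addO (linearP Phi).
  by have /injPhi[] : Phi (0, u) = Phi (0, v) by rewrite !oddE uv.
- move=> i f; have /= := actPhi _ (0, f) (delta_ix_bar_sl i).
  by rewrite exp_act_raise evE oddE exp_act_raise => -[].
- move=> i f; have /= := actPhi _ (f, 0) (delta_bar_ix_sl i).
  by rewrite exp_act_lower evE oddE exp_act_lower => -[].
Qed.

End FromIso.

Section LadderLeads.
Variables (C : numClosedFieldType) (m : nat) (k : 'I_m -> nat).
Variables (a b : 'I_m -> C) (S1 S2 : {set 'I_m}).
Hypotheses (k_gt0 : forall i, (0 < k i)%N) (a0 : forall i, a i != 0)
  (b0 : forall i, b i != 0).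
Variable Phi : int -> {mpoly C[m]} -> {mpoly C[m]}.
Hypothesis ladderPhi : forall n,
  linked (raise (potential a k) S1) (lower (potential a k) S1)
         (raise (potential b k) S2) (lower (potential b k) S2)
         (Phi n) (Phi (n + 1)).

Let linPhi n : linear (Phi n). Proof. by case: (ladderPhi n) => -[]. Qed.
Let Xim := imX (potential b k) S1 S2.
Let Dim := imD (potential b k) S1 S2.

(** For [i \in S1] multiplication by x_i is - B_i and lowers the index, so the
    relation used is that of the pair below [n]. *)
Lemma ladder_mulX n i f : Phi n ('X_i * f) = Xim i (Phi (n + sgS S1 i) f).
Proof.
rewrite /Xim /imX /sgS; case: ifP => iS.
  have [_ _ _] := ladderPhi (n - 1); rewrite subrK => /(_ i f).
  by rewrite {1}/lower iS (linear_propN (linPhi _)) => <-; rewrite opprK.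
by have [_ _ /(_ i f) + _] := ladderPhi n; rewrite {1}/raise iS.
Qed.

Lemma ladder_covd n i f :
  Phi (n + sgS S1 i) (covd (potential a k) i f) = Dim i (Phi n f).
Proof.
rewrite /Dim /imD /sgS; case: ifP => iS.
  have [_ _ /(_ i f) + _] := ladderPhi (n - 1).
  by rewrite subrK {1}/raise iS.
by have [_ _ _ /(_ i f)] := ladderPhi n; rewrite {1}/lower iS.
Qed.

Lemma ladder_expX n i d f :
  Phi n ('X_i ^+ d * f) = iter d (Xim i) (Phi (n + sgS S1 i * d%:Z) f).
Proof.
elim: d n f => [|d IH] n f; first by rewrite mul1r mulr0 addr0.
by rewrite exprS -mulrA ladder_mulX IH -addrA -[d.+1]add1n PoszD mulrDr mulr1.
Qed.

Let p n := Phi n 1.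

Lemma ladder_neq0 n : p n != 0.
Proof.
have [[_ inj] _ _ _] := ladderPhi n.
apply/eqP => pn0; have /eqP := oner_neq0 {mpoly C[m]}; apply.
by apply: inj; rewrite (linear_prop0 (linPhi n)).
Qed.

(** The ladder applied to D_i 1 = k_i a_i x_i^(k_i - 1). *)
Lemma ladder_vacuum n i :
  (a i * (k i)%:R) *: iter (k i).-1 (Xim i) (p (n + sgS S1 i * (k i)%:Z)) =
  Dim i (p n).
Proof.
rewrite -ladder_covd /covd -mpolyC1 mderivC add0r mpolyC1 mul1r mderiv_potential.
rewrite (linear_propZ (linPhi _)) -[_ ^+ _]mulr1 ladder_expX -addrA.
congr (_ *: iter _ _ (p (_ + _))).
by rewrite -{1}(prednK (k_gt0 i)) -add1n PoszD mulrDr mulr1.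
Qed.


Lemma Xim_lead i : shifts_lead (Xim i)
  (U_(i) *+ (if (i \in S1) (+) (i \in S2) then (k i).-1 else 1%N))%MM
  (if (i \in S1) (+) (i \in S2) then (if i \in S1 then -1 else 1) * (b i * (k i)%:R)
   else 1).
Proof.
have hr := raise_lead k_gt0 S2 (b0 i); have hl := lower_lead k_gt0 S2 (b0 i).
rewrite /Xim /imX; case: (i \in S1); case: ifP hr hl => iS2 //= hr hl.
- by rewrite -[1]opprK; apply: shifts_leadN.
- by rewrite mulN1r; apply: shifts_leadN.
- by rewrite mul1r.
Qed.

Lemma Dim_lead i : shifts_lead (Dim i)
  (U_(i) *+ (if (i \in S1) (+) (i \in S2) then 1%N else (k i).-1))%MM
  (if (i \in S1) (+) (i \in S2) then (if i \in S1 then 1 else -1)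
   else b i * (k i)%:R).
Proof.
have hr := raise_lead k_gt0 S2 (b0 i); have hl := lower_lead k_gt0 S2 (b0 i).
by rewrite /Dim /imD; case: (i \in S1); case: ifP hr hl.
Qed.

Lemma ladder_lead n i (dX dD : nat) (cX cD : C) :
  shifts_lead (Xim i) (U_(i) *+ dX)%MM cX ->
  shifts_lead (Dim i) (U_(i) *+ dD)%MM cD ->
  let n' := n + sgS S1 i * (k i)%:Z in
  (dX * (k i).-1 + mdeg (mlead (p n')) = dD + mdeg (mlead (p n)))%N /\
  a i * (k i)%:R * cX ^+ (k i).-1 * mleadc (p n') = cD * mleadc (p n).
Proof.
move=> hX hD n'; have E := ladder_vacuum n i; rewrite -/n' in E.
have [_ hm hc] := shifts_lead_iter (k i).-1 hX (ladder_neq0 n').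
have [hm' hc'] := hD.2 _ (ladder_neq0 n).
have ak0 := slope_neq0 k_gt0 (a0 i).
have Em := congr1 (@mlead _ _) E; rewrite mleadZ // hm hm' in Em.
split.
  by have := congr1 mdeg Em; rewrite !mdegD !mdegMn mdeg1 !mul1n => ->.
by rewrite -mulrA -hc -mleadcZE E hc'.
Qed.

(** For [i] in the symmetric difference, [Xim i] is D'_i up to sign and [Dim i]
    is x_i up to sign. If k_i = 1 the degrees decrease against the direction
    [sgS S1 i], if k_i >= 3 they decrease along it. *)
Lemma ladder_k2 i : (i \in S1) (+) (i \in S2) -> k i = 2%N.
Proof.
move=> iT; have hX := Xim_lead i; have hD := Dim_lead i.
rewrite iT in hX hD; pose d n := mdeg (mlead (p n)).
have step n : ((k i).-1 * (k i).-1 + d (n + sgS S1 i * (k i)%:Z)%R = 1 + d n)%N.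
  by have [] := ladder_lead n hX hD.
have ki := k_gt0 i; have [k1|k1|//] := ltngtP (k i) 2%N.
- have E1 : k i = 1%N by lia.
  case: (@no_int_descent d (- sgS S1 i)) => n.
  have := step (n - sgS S1 i); rewrite E1 mulr1 subrK /=; lia.
- case: (@no_int_descent d (sgS S1 i * (k i)%:Z)) => n.
  have := step n; have : (4 <= (k i).-1 * (k i).-1)%N by apply: (@leq_mul 2 2); lia.
  by move: (_ * _)%N (d _) (d n) => q u v; lia.
Qed.

Lemma ladder_rho i : mult_shift (fun n => mleadc (p n)) (sgS S2 i * (k i)%:Z)
  (rho S1 S2 a b i).
Proof.
have hX := Xim_lead i; have hD := Dim_lead i.
have kR : (k i)%:R != 0 :> C by rewrite pnatr_eq0 -lt0n.
rewrite /rho; have := @ladder_k2 i; case: ifP hX hD => iT hX hD k2 n.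
  have {k2} k2 := k2 isT; have s12 : sgS S2 i = - sgS S1 i.
    by rewrite /sgS; case: (i \in S1) (i \in S2) iT => [] [].
  have [_ /=] := ladder_lead (n + sgS S2 i * (k i)%:Z) hX hD.
  rewrite s12 mulNr subrK k2 expr1 => E.
  case: ifP E => _; rewrite ?mulN1r ?mul1r => E.
  - by rewrite -E; ring.
  - by apply: oppr_inj; rewrite -E; ring.
have s12 : sgS S2 i = sgS S1 i.
  by rewrite /sgS; case: (i \in S1) (i \in S2) iT => [] [].
have [_ /=] := ladder_lead n hX hD; rewrite s12 expr1n mulr1 => E.
apply: (mulfI (slope_neq0 k_gt0 (a0 i))); rewrite E; field.
exact: a0.
Qed.

End LadderLeads.

Lemma iso_compatible (C : numClosedFieldType) m (k : 'I_m -> nat)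
    (a b : 'I_m -> C) (S1 S2 : {set 'I_m}) :
  (1 < m)%N -> (forall i, (0 < k i)%N) ->
  (forall i, a i != 0) -> (forall i, b i != 0) ->
  sl_iso (expmod (potential a k) S1) (expmod (potential b k) S2) ->
  exists2 mu, mu != 0 & compatible S1 S2 a b k mu.
Proof.
move=> m1 k0 a0 b0 /iso_linked[phi [psi start]].
have [Phi hPhi] := ladder m1 (weyl_raise k0 S1 a0) (weyl_raise k0 S2 b0)
  (weyl_lower k0 S1 a0) (weyl_lower k0 S2 b0) start.
have nu0 n : mleadc (Phi n 1) != 0 by rewrite mleadc_eq0 (ladder_neq0 hPhi).
have t0 i : sgS S2 i * (k i)%:Z != 0.
  by rewrite mulf_neq0 ?eqz_nat -?lt0n // /sgS; case: ifP.
have [mu mu0 hmu] := common_root (ltnW m1) nu0 t0 (ladder_rho k0 a0 b0 hPhi).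
by exists mu => // i; split; [exact: (ladder_k2 k0 a0 b0 hPhi) | exact: hmu].
Qed.

(** * Linear maps out of the polynomials *)

Section Cyclic.
Variables (F : fieldType) (m : nat) (V : lmodType F).
Implicit Types (P Q : {mpoly F[m]} -> V) (L : 'I_m -> V -> V) (w : 'X_{1..m} -> V).

Definition monomial_ext w (f : {mpoly F[m]}) : V := \sum_(e <- msupp f) f@_e *: w e.

Lemma monomial_ext_linear w : linear (monomial_ext w).
Proof.
have extE d f : (msize f <= d)%N ->
    monomial_ext w f = \sum_(e : 'X_{1..m < d}) f@_e *: w e.
  move=> le_fd; rewrite /monomial_ext (big_mksub ('X_{1..m < d})) //=; first last.
  - by move=> x /msize_mdeg_lt/leq_trans/(_ le_fd).
  - by rewrite msupp_uniq.
  by rewrite big_rmcond //= => j /memN_msupp_eq0 ->; rewrite scale0r.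
move=> c p q; pose d := maxn (msize (c *: p + q)) (maxn (msize p) (msize q)).
rewrite !(extE d) ?leq_max ?leqnn ?orbT //.
rewrite scaler_sumr -big_split; apply: eq_bigr => e _ /=.
by rewrite mcoeffD mcoeffZ scalerDl scalerA.
Qed.

Lemma monomial_extX w e : monomial_ext w 'X_[e] = w e.
Proof. by rewrite /monomial_ext msuppX big_seq1 mcoeffX eqxx scale1r. Qed.

Lemma linear_eq_monomials P Q : linear P -> linear Q ->
  (forall e, P 'X_[e] = Q 'X_[e]) -> P =1 Q.
Proof.
move=> linP linQ PQ; elim/mpolyind => [|c e f _ _ IH].
  by rewrite (linear_prop0 linP) (linear_prop0 linQ).
by rewrite linP linQ PQ IH.
Qed.

Lemma linear_eq_cyclic P Q L : linear P -> linear Q -> P 1 = Q 1 ->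
  (forall i f, P ('X_i * f) = L i (P f)) ->
  (forall i f, Q ('X_i * f) = L i (Q f)) -> P =1 Q.
Proof.
move=> linP linQ PQ1 PL QL; apply: linear_eq_monomials => // e.
have [n] := ubnP (mdeg e); elim: n e => // n IH e le_en.
have [/eqP|e0] := eqVneq (mdeg e) 0%N.
  by rewrite mdeg_eq0 => /eqP ->; rewrite mpolyX0.
have [i ei] : exists i, e i != 0%N.
  apply/existsP; apply: contraNT e0 => /existsPn h.
  by rewrite mdeg_eq0; apply/eqP/mnmP => i; rewrite mnm0E; apply/eqP/negPn/h.
have eE : e = (U_(i) + (e - U_(i)))%MM.
  by rewrite addmC submK // lep1mP.
rewrite eE mpolyXD PL QL IH //.
by move: le_en; rewrite {1}eE mdegD mdeg1.
Qed.

Lemma cyclic_exists L v0 : (forall i, linear (L i)) ->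
  (forall i j v, L i (L j v) = L j (L i v)) ->
  exists P, [/\ linear P, P 1 = v0 & forall i f, P ('X_i * f) = L i (P f)].
Proof.
move=> linL LC.
pose pow (s : seq 'I_m) (e : 'X_{1..m}) :=
  foldr (fun i v => iter (e i) (L i) v) v0 s.
have iterC i j n v : L i (iter n (L j) v) = iter n (L j) (L i v).
  by elim: n => //= n IH; rewrite LC IH.
have powC i s e : L i (pow s e) = foldr (fun i v => iter (e i) (L i) v) (L i v0) s.
  by elim: s => //= j s IH; rewrite iterC IH.
have powD i s e : uniq s ->
    pow s (U_(i) + e)%MM = if i \in s then L i (pow s e) else pow s e.
  elim: s => //= j s IH /andP[js us]; rewrite (IH us) mnmDE mnm1E inE.
  have [->|ij] := eqVneq i j; first by rewrite (negPf js).
  by rewrite add0n /=; case: ifP => // _; rewrite iterC.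
exists (monomial_ext (pow (enum 'I_m))); split; first exact: monomial_ext_linear.
- rewrite -mpolyX0 monomial_extX /pow; elim: (enum _) => //= j s ->.
  by rewrite mnm0E.
- move=> i; apply: linear_eq_monomials => [c u v|c u v|e].
  + by rewrite mulrDr -scalerAr monomial_ext_linear.
  + by rewrite monomial_ext_linear linL.
  + by rewrite -mpolyXD !monomial_extX powD ?enum_uniq // mem_enum.
Qed.

(** C[x] with the operators x_i, D_i is generated by 1 subject only to the Weyl
    relations and D_i 1 = k_i a_i x_i^(k_i - 1), hence maps to any space with
    such operators. The map is determined by the [L i]; its defect
    [P (covd _ j f) - D j (P f)] commutes with the action of the x_i and
    vanishes at 1, so it vanishes. *)
Lemma vacuum_map (a : 'I_m -> F) k L D v0 :
  (forall i, linear (L i)) -> (forall i, linear (D i)) ->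
  (forall i j v, L i (L j v) = L j (L i v)) ->
  (forall i j v, D j (L i v) = (j == i)%:R *: v + L i (D j v)) ->
  (forall i, D i v0 = (a i * (k i)%:R) *: iter (k i).-1 (L i) v0) ->
  exists P, [/\ linear P, P 1 = v0, forall i f, P ('X_i * f) = L i (P f) &
    forall i f, P (covd (potential a k) i f) = D i (P f)].
Proof.
move=> linL linD LC DL Dv0; have [P [linP P1 PL]] := cyclic_exists v0 linL LC.
exists P; split=> // j f; apply/eqP; rewrite -subr_eq0; apply/eqP.
have PX i n f' : P ('X_i ^+ n * f') = iter n (L i) (P f').
  by elim: n => [|n IH]; rewrite ?mul1r // exprS -mulrA PL IH.
apply: (linear_eq_cyclic (P := fun f => P (covd (potential a k) j f) - D j (P f))
  (Q := fun=> 0) (L := L)) f => [c u v|c u v||i f|i f].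
- by rewrite covd_linear !linP linD scalerBr opprD addrACA.
- by rewrite scaler0 addr0.
- rewrite /covd -mpolyC1 mderivC add0r mpolyC1 mul1r mderiv_potential P1 Dv0.
  by rewrite (linear_propZ linP) -[_ ^+ _]mulr1 PX P1 subrr.
- have -> : covd (potential a k) j ('X_i * f) =
      (j == i)%:R *: f + 'X_i * covd (potential a k) j f.
    by have /= := congr1 fst (op_dx_x (potential a k) i j (f, 0)).
  rewrite linP PL (PL i f) DL (linear_propB (linL i)) opprD addrACA subrr add0r //.
- by rewrite (linear_prop0 (linL i)).
Qed.

End Cyclic.

(** * From the parameters to an isomorphism *)

Section FromParameters.
Variables (F : numFieldType) (m : nat) (k : 'I_m -> nat).
Hypothesis k_gt0 : forall i, (0 < k i)%N.
Implicit Types (a b : 'I_m -> F) (S : {set 'I_m}) (mu : F).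

Lemma compatible_sym S1 S2 a b mu : mu != 0 ->
  compatible S1 S2 a b k mu -> compatible S2 S1 b a k mu^-1.
Proof.
move=> mu0 h i; have [hk hr] := h i; split; first by rewrite addbC.
have -> : rho S2 S1 b a i = if (i \in S1) (+) (i \in S2) then rho S1 S2 a b i
    else (rho S1 S2 a b i)^-1.
  rewrite /rho addbC; case: ifP => _; last by rewrite invf_div.
  by ring.
rewrite -hr exprz_inv invr_expz /sgS.
by case: (i \in S1); case: (i \in S2); rewrite /= ?mulN1r ?mul1r ?opprK.
Qed.

Lemma imX_linear g S1 S2 i : linear (@imX F m g S1 S2 i).
Proof.
move=> c u v; rewrite /imX; case: ifP => _; last exact: raise_linear.
by rewrite /= lower_linear opprD scalerN.
Qed.

Lemma imD_linear g S1 S2 i : linear (@imD F m g S1 S2 i).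
Proof.
move=> c u v; rewrite /imD; case: ifP => _;
  [exact: raise_linear | exact: lower_linear].
Qed.

Lemma imX_C g S1 S2 i j f :
  imX g S1 S2 i (imX g S1 S2 j f) = imX g S1 S2 j (@imX F m g S1 S2 i f).
Proof.
have [->//|ij] := eqVneq i j; rewrite /imX.
case: ifP => _; case: ifP => _; rewrite ?(linear_propN (@lower_linear _ _ _ _ _))
  ?(linear_propN (@raise_linear _ _ _ _ _)).
- by rewrite lowerC.
- by rewrite lower_raise (negPf ij) scale0r add0r.
- by rewrite lower_raise eq_sym (negPf ij) scale0r add0r.
- by rewrite raiseC.
Qed.

Lemma imD_imX g S1 S2 i j f : imD g S1 S2 j (imX g S1 S2 i f) =
  (j == i)%:R *: f + imX g S1 S2 i (@imD F m g S1 S2 j f).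
Proof.
rewrite /imX /imD.
case: ifP => iS; case: ifP => jS; rewrite ?(linear_propN (@lower_linear _ _ _ _ _))
  ?(linear_propN (@raise_linear _ _ _ _ _)).
- by rewrite lower_raise eq_sym opprD addNKr.
- have -> : (j == i) = false by apply/eqP => ji; move: iS jS; rewrite ji => ->.
  by rewrite raiseC scale0r add0r.
- have -> : (j == i) = false by apply/eqP => ji; move: iS jS; rewrite ji => ->.
  by rewrite lowerC scale0r add0r.
- exact: lower_raise.
Qed.

Lemma covd1 b i :
  covd (potential b k) i 1 = (b i * (k i)%:R) *: 'X_i ^+ (k i).-1.
Proof. by rewrite /covd -mpolyC1 mderivC add0r mpolyC1 mul1r mderiv_potential. Qed.

(** The conditions on [mu] are exactly what makes the constant 1 satisfy the
    vacuum equation for the rescaled operators. *)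
Lemma compatible_vacuum S1 S2 a b mu i : mu != 0 -> a i != 0 ->
  compatible S1 S2 a b k mu ->
  mu ^ (- sgS S1 i) *: imD (potential b k) S1 S2 i 1 =
  (a i * (k i)%:R) *: iter (k i).-1
    (fun f => mu ^ sgS S1 i *: imX (potential b k) S1 S2 i f) 1.
Proof.
move=> mu0 ai0 /(_ i) []; rewrite /rho /imD /imX /sgS /raise /lower.
have iterX c n : iter n (fun f : {mpoly F[m]} => c *: ('X_i * f)) 1 =
    c ^+ n *: 'X_i ^+ n.
  elim: n => [|n IH] /=; first by rewrite !expr0 scale1r.
  by rewrite IH -scalerAr scalerA !exprS.
case: (boolP (i \in S1)) => iS1; case: (boolP (i \in S2)) => iS2 /=.
- rewrite mulN1r -exprnN => _ E; rewrite opprK expr1z covd1 scalerA.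
  rewrite (eq_iter (f' := fun f => mu^-1 *: ('X_i * f))); last first.
    by move=> f; rewrite opprK exprN1.
  rewrite iterX scalerA; congr (_ *: _).
  have -> : b i = mu ^- k i * a i by rewrite E divfK.
  by rewrite -(prednK (k_gt0 i)) exprVn exprS; field; rewrite expf_neq0 ?mu0.
- rewrite mul1r => /(_ isT) k2 E; rewrite opprK expr1z mulr1 k2 /= covd1 k2 /=.
  rewrite scalerN -scaleNr !scalerA; congr (_ *: _).
  have -> : b i = - (mu ^+ 2 / (4%:R * a i)).
    by rewrite k2 in E; rewrite [mu ^+ 2]E; field.
  by rewrite [mu ^ _]exprN1; field; rewrite ai0 mu0.
- rewrite mulN1r -exprnN => /(_ isT) k2 E; rewrite expr1z mulr1 k2 /= covd1 k2 /=.
  rewrite scalerN -scaleNr !scalerA; congr (_ *: _).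
  have -> : b i = - (mu ^- 2 / (4%:R * a i)) by rewrite k2 in E; rewrite E; field.
  by rewrite [mu ^ _]exprN1; field; rewrite ai0 mu0.
- rewrite mul1r => _ E; rewrite covd1 scalerA expr1z iterX scalerA; congr (_ *: _).
  have -> : b i = mu ^+ k i * a i by rewrite exprnP E divfK.
  by rewrite -(prednK (k_gt0 i)) exprS exprN1; field.
Qed.

Lemma compatible_map S1 S2 a b mu : mu != 0 -> (forall i, a i != 0) ->
  compatible S1 S2 a b k mu ->
  exists P : {mpoly F[m]} -> {mpoly F[m]}, [/\ linear P, P 1 = 1,
    forall i f, P (raise (potential a k) S1 i f) =
      mu *: raise (potential b k) S2 i (P f) &
    forall i f, P (lower (potential a k) S1 i f) =
      mu^-1 *: lower (potential b k) S2 i (P f)].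
Proof.
move=> mu0 a0 cmp; set gb := potential b k.
pose L i f := mu ^ sgS S1 i *: imX gb S1 S2 i f.
pose D i f := mu ^ (- sgS S1 i) *: imD gb S1 S2 i f.
have linL i : linear (L i).
  by move=> c u v; rewrite /L imX_linear scalerDr !scalerA mulrC.
have linD i : linear (D i).
  by move=> c u v; rewrite /D imD_linear scalerDr !scalerA mulrC.
have LC i j f : L i (L j f) = L j (L i f).
  rewrite /L !(linear_propZ (@imX_linear gb S1 S2 _)) imX_C !scalerA.
  by rewrite mulrC.
have DL i j f : D j (L i f) = (j == i)%:R *: f + L i (D j f).
  rewrite /L /D (linear_propZ (@imX_linear gb S1 S2 _)).
  rewrite (linear_propZ (@imD_linear gb S1 S2 _)) imD_imX !scalerDr !scalerA.
  rewrite [X in _ + X *: _]mulrC; congr (_ + _).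
  have [->|_] := eqVneq j i; last by rewrite !mulr0.
  by rewrite -expfzDr // addNr expr0z mul1r.
have [P [linP P1 PX PD]] := vacuum_map linL linD LC DL
  (fun i => compatible_vacuum mu0 (a0 i) cmp).
exists P; split=> // i f.
- rewrite /raise; have := PX i f; have := PD i f; rewrite /L /D /imX /imD /sgS.
  by case: (i \in S1) => hD hX; rewrite ?hD ?hX ?opprK ?expr1z.
- rewrite /lower; have := PX i f; have := PD i f; rewrite /L /D /imX /imD /sgS.
  case: (i \in S1) => hD hX; rewrite ?hD ?(linear_propN linP) ?hX //.
  by rewrite scalerN opprK.
Qed.

Lemma compatible_iso S1 S2 a b mu : mu != 0 ->
  (forall i, a i != 0) -> (forall i, b i != 0) ->
  compatible S1 S2 a b k mu ->
  sl_iso (expmod (potential a k) S1) (expmod (potential b k) S2).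
Proof.
move=> mu0 a0 b0 cmp.
have [P [linP P1 Pr Pl]] := compatible_map mu0 a0 cmp.
have mu'0 : mu^-1 != 0 by rewrite invr_eq0.
have [Q [linQ Q1 Qr Ql]] := compatible_map mu'0 b0 (compatible_sym mu0 cmp).
rewrite invrK in Ql.
(* the composite commutes with all x_i and fixes 1 *)
have inverse (S S' : {set 'I_m}) c d (U W : {mpoly F[m]} -> {mpoly F[m]}) nu :
    nu != 0 -> linear U -> linear W -> U 1 = 1 -> W 1 = 1 ->
    (forall i f, U (raise (potential c k) S i f) =
      nu *: raise (potential d k) S' i (U f)) ->
    (forall i f, U (lower (potential c k) S i f) =
      nu^-1 *: lower (potential d k) S' i (U f)) ->
    (forall i f, W (raise (potential d k) S' i f) =
      nu^-1 *: raise (potential c k) S i (W f)) ->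
    (forall i f, W (lower (potential d k) S' i f) =
      nu *: lower (potential c k) S i (W f)) ->
    cancel U W.
  move=> nu0 linU linW U1 W1 Ur Ul Wr Wl.
  apply: (linear_eq_cyclic (P := fun f => W (U f)) (Q := id)
    (L := fun i f => 'X_i * f)) => [u x y|u x y||i f|//] //.
  - by rewrite linU linW.
  - by rewrite U1 W1.
  - have := Ur i f; have := Ul i f;
    rewrite [raise _ S i f]/raise [lower _ S i f]/lower.
    case: ifP => iS.
      rewrite (linear_propN linU) => E _; apply: oppr_inj.
      rewrite -(linear_propN linW) E (linear_propZ linW) Wl scalerA mulVf //.
      rewrite scale1r.
      by rewrite /lower iS.
    move=> _ ->; rewrite (linear_propZ linW) Wr scalerA mulfV // scale1r.
    by rewrite /raise iS.
have QP : cancel P Q by apply: (inverse S1 S2 a b P Q mu).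
have PQ : cancel Q P.
  by apply: (inverse S2 S1 b a Q P mu^-1) => //; rewrite ?invrK.
(* the factor mu in the odd half absorbs the one in Pr and Pl *)
pose Phi (v : expvec F m) : expvec F m := (P v.1, mu *: P v.2).
have linPhi : linear Phi.
  move=> c u v; apply: expvec_eq; rewrite /= linP // scalerDr !scalerA.
  by rewrite mulrC.
pose Phil : {linear expvec F m -> expvec F m} := HB.pack Phi
  (GRing.isLinear.Build F (expvec F m) (expvec F m) _ Phi linPhi).
exists Phil; split.
- exists (fun v => (Q v.1, mu^-1 *: Q v.2)) => v; apply: expvec_eq => /=.
  + exact: QP.
  + by rewrite (linear_propZ linQ) QP scalerA mulVf // scale1r.
  + exact: PQ.
  + by rewrite (linear_propZ linP) PQ scalerA mulfV // scale1r.
- by case=> v /= ->; rewrite (linear_prop0 linP) ?scaler0.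
have Phi_a p v : Phi (gen_a (potential a k) S1 p v) =
    mu *: gen_a (potential b k) S2 p (Phi v).
  elim/ixP: p => [i|]; last first.
    rewrite !gen_a_bar; apply: expvec_eq; rewrite /= ?scaler0 //.
    exact: linear_prop0 linP.
  rewrite !gen_a_ixE; apply: expvec_eq; rewrite /= Pr //.
  by rewrite (linear_propZ (@raise_linear _ _ _ _ _)).
have Phi_b p v : Phi (gen_b (potential a k) S1 p v) =
    mu^-1 *: gen_b (potential b k) S2 p (Phi v).
  elim/ixP: p => [i|]; last first.
    rewrite !gen_b_bar; apply: expvec_eq => /=.
      by rewrite scalerA mulVf // scale1r.
    by rewrite (linear_prop0 linP) !scaler0.
  rewrite !gen_b_ixE; apply: expvec_eq; rewrite /= Pl //.
  by rewrite (linear_propZ (@lower_linear _ _ _ _ _)) !scalerA mulrC.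
move=> X v Xsl /=; rewrite !exp_actE ?sl_supertrace // /gl_act.
rewrite -[Phi _]/(Phil _) (linear_sum Phil); apply: eq_bigr => p _.
rewrite (linear_sum Phil); apply: eq_bigr => q _.
rewrite -[Phil _]/(Phi _) (linear_propZ linPhi); congr (_ *: _).
by rewrite Phi_a Phi_b linearZ scalerA mulfV // scale1r.
Qed.

End FromParameters.

(** * The group action and the weighted projective space *)

Section Orbits.
Variables (F : numFieldType) (m : nat) (k : 'I_m -> nat).
Implicit Types (a b : 'I_m -> F) (S : {set 'I_m}) (e : Gk k).

Lemma SuppP e i : reflect (exists2 j, val j = i & e j = 1) (i \in Supp e).
Proof.
apply: (iffP imsetP) => [[j]|[j <- ej]].
  by rewrite inE => /eqP ej ->; exists j.
by exists j; rewrite // inE ej.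
Qed.

Lemma Supp_k2 e i : i \in Supp e -> k i = 2%N.
Proof. by case/SuppP => j <- _; have := valP j; rewrite inE => /eqP. Qed.

Lemma Gk_actE e a i :
  Gk_act e a i = if i \in Supp e then - (4%:R * a i)^-1 else a i.
Proof.
rewrite /Gk_act; case: insubP => [j _ ji|iN].
  have [e1|e1] := eqVneq (e j) 1.
    have -> : i \in Supp e by apply/SuppP; exists j.
    by rewrite e1 /= expr1 exprN1 invfM mul1r mulNr.
  have -> : (i \in Supp e) = false.
    apply/negP => /SuppP[j' j'i ej']; case/eqP: e1; rewrite -ej'.
    by congr (e _); apply: val_inj; rewrite j'i.
  have -> : e j = 0.
    by apply/val_inj; move: e1; rewrite -val_eqE; case: (e j) => -[|[|]].
  by rewrite expr0 mul1r mulr0 subr0 expr1z.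
have -> // : (i \in Supp e) = false.
by apply: contraNF iN => /Supp_k2 ki; rewrite inE ki.
Qed.

Lemma twist_scale S (l : F) (n : nat) i (c d : 'I_m -> F) :
  l != 0 -> c i != 0 -> d i != 0 ->
  (twist S c i = l ^+ n * twist S d i) <-> (l ^ (sgS S i * n%:Z) = d i / c i).
Proof.
move=> l0 c0 d0; rewrite /twist /sgS; have ln0 : l ^+ n != 0 by rewrite expf_neq0.
case: ifP => _; rewrite ?mulN1r ?mul1r -?exprnN -?exprnP; split => E.
- by rewrite E; field; rewrite d0.
- by rewrite -(mulfVK d0 (c i)) -[c i / d i]invf_div -E invrK.
- by rewrite E mulrCA mulfV // mulr1.
- by rewrite E; field; rewrite ?c0 ?d0.
Qed.

Lemma symdiffE (S1 S2 : {set 'I_m}) i :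
  (i \in S1 :\: S2 :|: S2 :\: S1) = (i \in S1) (+) (i \in S2).
Proof. by rewrite !inE; case: (i \in S1) (i \in S2) => [] []. Qed.

Lemma compatible_orbit S1 S2 a b :
  (forall i, a i != 0) -> (forall i, b i != 0) ->
  (exists2 mu, mu != 0 & compatible S1 S2 a b k mu) <->
  exists e : Gk k, Supp e = S1 :\: S2 :|: S2 :\: S1 /\
    wproj_eq k (twist S2 (Gk_act e a)) (twist S2 b).
Proof.
move=> a0 b0.
have ea0 e i : Gk_act e a i != 0.
  by rewrite Gk_actE; case: ifP; rewrite // oppr_eq0 invr_eq0 mulf_neq0 ?pnatr_eq0.
have rhoE e : Supp e = S1 :\: S2 :|: S2 :\: S1 ->
    forall i, rho S1 S2 a b i = b i / Gk_act e a i.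
  move=> eT i; rewrite Gk_actE eT symdiffE /rho; case: ifP => // _.
  by rewrite invrN invrK mulrN mulrC.
split=> [[mu mu0 cmp]|[e [eT [l l0 hl]]]]; last first.
  exists l => // i; split; first by rewrite -symdiffE -eT => /Supp_k2.
  by rewrite (rhoE e eT); apply/(twist_scale S2 (k i) l0 (ea0 e i) (b0 i)).
pose e : Gk k := [ffun j => if val j \in S1 :\: S2 :|: S2 :\: S1 then 1 else 0].
have eT : Supp e = S1 :\: S2 :|: S2 :\: S1.
  apply/setP => i; apply/SuppP/idP => [[j <-]|iT].
    by rewrite ffunE; case: ifP.
  have iN : i \in Nk k by rewrite inE (cmp i).1 // -symdiffE.
  by exists (Sub i iN); rewrite ?SubK // ffunE SubK iT.
exists e; split=> //; exists mu => // i.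
apply/(twist_scale S2 (k i) mu0 (ea0 e i) (b0 i)).
by rewrite -(rhoE e eT) (cmp i).2.
Qed.

End Orbits.

Unset Implicit Arguments.
Theorem theorem5p20 (R : realType) (m : nat) (hm : (2 <= m)%N)
    (S1 S2 : {set 'I_m}) (a b : 'I_m -> R[i]) (k : 'I_m -> nat)
    (ha : forall i, a i != 0) (hb : forall i, b i != 0)
    (hk : forall i, (1 <= k i)%N) :
  sl_iso (expmod (\sum_(i < m) a i *: 'X_i ^+ k i) S1)
         (expmod (\sum_(i < m) b i *: 'X_i ^+ k i) S2) <->
  exists g : Gk k,
    Supp g = (S1 :\: S2) :|: (S2 :\: S1) /\
    wproj_eq k (twist S2 (Gk_act g a)) (twist S2 b).
Proof.
apply: iff_trans (compatible_orbit k S1 S2 ha hb); split.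
- exact: iso_compatible.
- by case=> mu mu0; apply: compatible_iso.
Qed.
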